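(* Let $\mu$ be a bounded perturbation of the uniform distribution on $[a,b]$ and let $K$ be the reproducing kernel of $H^1(\mu)$. Then, for every set $X$ of $n\ge 1$ distinct quadrature nodes in $[a,b]$, $$w^\star(X,K)=K(X,X)^{-1}\mathbb{1},$$ where $\mathbb{1}$ is the vector of ones of length $n$, and $$\bigl(\mathrm{wce}(X,w^\star(X,K),K)\bigr)^2=1-\mathbb{1}^\top K(X,X)^{-1}\mathbb{1}=1-\sum_{i=1}^n w_i^\star(X,K).$$ Similarly, for every integer $M\ge1$, when $X$ is formed by at most $M+1$ distinct points, both of these formulas hold with $K$ replaced by $K_M$. In particular, if $(X_P,w_P)$ is the Poincaré quadrature with $n$ nodes and $M=2n-1$, then $$w_P=K_M(X_P,X_P)^{-1}\mathbb{1}.$$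
   Context: Let $-\infty<a<b<\infty$. A probability distribution $\mu$ on $[a,b]$ is a bounded perturbation of the uniform distribution if it has a density $\rho$ that is positive, continuous and piecewise $C^1$ on $[a,b]$. Write $\|f\|^2=\int_a^b f^2\,d\mu$, $\langle f,g\rangle=\int_a^b fg\,d\mu$, $H^1(\mu)=\{f\in L^2(\mu): f'\in L^2(\mu)\}$ (weak derivatives; elements identified with their continuous representatives), with norm $\|f\|_{H^1(\mu)}^2=\|f\|^2+\|f'\|^2$. With this norm $H^1(\mu)$ is a reproducing kernel Hilbert space. Poincaré basis: the problem of finding $f\in H^1(\mu)$ and $\lambda$ with $\langle f',g'\rangle=\lambda\langle f,g\rangle$ for all $g\in H^1(\mu)$ has simple eigenvalues $0=\lambda_0<\lambda_1<\cdots\to\infty$; the $L^2(\mu)$-normalized eigenfunctions $(\varphi_m)_{m\ge0}$ (unique up to sign, $\varphi_0=1$) form an orthonormal basis of $L^2(\mu)$ and are continuous. Set $\alpha_m=(1+\lambda_m)^{-1}$. The kernel of $H^1(\mu)$ is $K(x,y)=\sum_{m\ge0}\alpha_m\varphi_m(x)\varphi_m(y)$ (uniformly convergent on $[a,b]^2$), and $K_M(x,y)=\sum_{m=0}^M\alpha_m\varphi_m(x)\varphi_m(y)$. A quadrature with $n$ nodes is a pair $(X,w)$ with $X=(x_1,\dots,x_n)\in[a,b]^n$, $w\in\mathbb{R}^n$. For a kernel $\kappa$ with reproducing kernel Hilbert space $\mathcal{H}_\kappa$, $\mathrm{wce}(X,w,\kappa)=\sup_{h\in\mathcal{H}_\kappa,\|h\|_{\mathcal{H}_\kappa}\le1}\left|\int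 h\,d\mu-\sum_{i=1}^n w_ih(x_i)\right|$; $\kappa(X,X)=(\kappa(x_i,x_j))_{1\le i,j\le n}$ is the Gram matrix; when it is invertible, $w^\star(X,\kappa)=(w_i^\star(X,\kappa))_i$ denotes the unique minimizer of $w\mapsto\mathrm{wce}(X,w,\kappa)$ over $\mathbb{R}^n$. (It is known that $K(X,X)$ is invertible for distinct nodes, and $K_M(X,X)$ is invertible for at most $M+1$ distinct nodes.) The Poincaré quadrature $(X_P,w_P)$ with $n$ nodes is the unique quadrature with $n$ nodes in $[a,b]$ and positive weights that is exact for $\varphi_0,\dots,\varphi_{2n-1}$, i.e. $\int\varphi_m\,d\mu=\sum_i w_i\varphi_m(x_i)$ for $0\le m\le 2n-1$ (existence and uniqueness are known because the Poincaré basis is, up to signs, a Tchebytchev system). *)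

(* Defs.v *)
From HB Require Import structures.
From mathcomp Require Import all_boot all_order all_algebra all_fingroup.
From mathcomp Require Import all_classical all_reals all_analysis.

Set Implicit Arguments.
Unset Strict Implicit.
Unset Printing Implicit Defensive.

Import Order.TTheory GRing.Theory Num.Theory.
Import numFieldNormedType.Exports.

Local Open Scope classical_set_scope.
Local Open Scope ring_scope.

(* A function on [a, b] is represented by a total function R -> R whose values
   outside [a, b] are irrelevant: every notion below only looks at its
   restriction to [a, b]. *)

Section BoundedPerturbation.
Context {R : realType}.
Implicit Types (a b : R) (f g rho : R -> R).

(* [f] is C^1 on the closed interval [c, d], given that it is continuous
   there: the derivative extends continuously to the end points. *)
Definition C1_between f (c d : R) :=
  [/\ forall x, x \in `]c, d[ -> derivable f x 1,
      forall x, x \in `]c, d[ -> {for x, continuous (derive1 f)},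
      cvg (derive1 f @ c^'+) & cvg (derive1 f @ d^'-)].

Definition piecewise_C1 a b f :=
  exists (k : nat) (t : nat -> R),
    [/\ t 0%N = a, t k = b &
        forall i, (i < k)%N -> t i < t i.+1 /\ C1_between f (t i) (t i.+1)].

Definition bounded_perturbation a b (mu : probability (measurableTypeR R) R) :=
  exists rho,
    [/\ {within `[a, b], continuous rho},
        forall x, x \in `[a, b] -> 0 < rho x,
        piecewise_C1 a b rho &
        forall A : set (measurableTypeR R), measurable A ->
          mu A = (\int[lebesgue_measure]_(x in A `&` `[a, b]) (rho x)%:E)%E].

(* C^1 functions with compact support in ]a, b[; for locally integrable
   functions this class defines the same weak derivatives as the smooth one. *)
Definition test_function a b (phi : R -> R) :=
  [/\ forall x, derivable phi x 1,
      continuous (derive1 phi) &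
      exists c d, [/\ a < c, d < b & forall x, x \notin `[c, d] -> phi x = 0]].

Definition weak_derivative a b f g :=
  [/\ locally_integrable `]a, b[ f,
      locally_integrable `]a, b[ g &
      forall phi, test_function a b phi ->
        \int[lebesgue_measure]_(x in `]a, b[) (f x * derive1 phi x) =
        - \int[lebesgue_measure]_(x in `]a, b[) (g x * phi x)].

(* A chosen weak derivative; it is unique up to Lebesgue-null sets. *)
Definition wderiv a b f : R -> R := xget (cst 0) (weak_derivative a b f).

End BoundedPerturbation.

Section Sobolev.
Context {R : realType}.
Variables (a b : R) (mu : probability (measurableTypeR R) R).
Implicit Types f g : R -> R.

Definition L2 f := (f \_ `[a, b] : measurableTypeR R -> R) \in Lfun mu 2%:E.

Definition L2_inner f g : R := \int[mu]_(x in `[a, b]) (f x * g x).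

Definition L2_norm f : R := Num.sqrt (L2_inner f f).

(* Elements are the continuous representatives. *)
Definition in_H1 f :=
  [/\ {within `[a, b], continuous f}, L2 f &
      exists g, weak_derivative a b f g /\ L2 g].

Definition H1_inner f g : R :=
  L2_inner f g + L2_inner (wderiv a b f) (wderiv a b g).

End Sobolev.

Section RKHS.
Context {R : realType}.

(* Spaces of functions with a bilinear form, and the axioms making them
   reproducing kernel Hilbert spaces of functions on [D]. *)
Record inner_space := InnerSpace {
  carrier : set (R -> R);
  inner : (R -> R) -> (R -> R) -> R }.

Definition inner_norm (S : inner_space) (f : R -> R) : R :=
  Num.sqrt (inner S f f).

Definition is_hilbert (D : set R) (S : inner_space) :=
  [/\ carrier S 0,
      forall (k : R) f g, carrier S f -> carrier S g -> carrier S (k *: f + g),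
      [/\ forall (k : R) f g h, carrier S f -> carrier S g -> carrier S h ->
            inner S (k *: f + g) h = k * inner S f h + inner S g h,
          forall f g, carrier S f -> carrier S g -> inner S f g = inner S g f,
          forall f, carrier S f -> 0 <= inner S f f &
          forall f, carrier S f ->
            (inner S f f = 0 <-> forall x, D x -> f x = 0)] &
      forall u : nat -> R -> R, (forall n, carrier S (u n)) ->
        (forall e : R, 0 < e -> exists N, forall m n, (N <= m)%N -> (N <= n)%N ->
          inner_norm S (u m - u n) < e) ->
        exists2 f, carrier S f & inner_norm S (u n - f) @[n --> \oo] --> (0 : R)].

Definition reproducing_kernel (D : set R) (S : inner_space) (k : R -> R -> R) :=
  forall x, D x ->
    carrier S (k x) /\ forall f, carrier S f -> inner S f (k x) = f x.

Definition is_rkhs D S k := is_hilbert D S /\ reproducing_kernel D S k.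

End RKHS.
Arguments inner_space R : clear implicits.

Definition H1 {R : realType} (a b : R)
    (mu : probability (measurableTypeR R) R) : inner_space R :=
  InnerSpace (in_H1 a b mu) (H1_inner a b mu).

Section PoincareBasis.
Context {R : realType}.
Variables (a b : R) (mu : probability (measurableTypeR R) R).

Definition poincare_eigenpair (f : R -> R) (l : R) :=
  in_H1 a b mu f /\
  forall g, in_H1 a b mu g ->
    L2_inner a b mu (wderiv a b f) (wderiv a b g) = l * L2_inner a b mu f g.

(* Since the eigenfunctions [phi m] form an orthonormal basis and the [lam m]
   are pairwise distinct, the [lam m] are all the eigenvalues, and they are
   simple. *)
Definition poincare_basis (phi : nat -> R -> R) (lam : nat -> R) :=
  [/\ forall m, poincare_eigenpair (phi m) (lam m),
      [/\ lam 0%N = 0, forall m, lam m < lam m.+1 &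
          lam m @[m --> \oo] --> +oo],
      forall x, x \in `[a, b] -> phi 0%N x = 1,
      forall i j, L2_inner a b mu (phi i) (phi j) = (i == j)%:R &
      forall f, L2 a b mu f ->
        L2_norm a b mu
          (f - \sum_(m < N) L2_inner a b mu f (phi m) *: phi m)
          @[N --> \oo] --> (0 : R)].

End PoincareBasis.

Definition truncated_kernel {R : realType} (phi : nat -> R -> R)
    (lam : nat -> R) (M : nat) (x y : R) : R :=
  \sum_(m < M.+1) (1 + lam m)^-1 * phi m x * phi m y.

Section Quadrature.
Context {R : realType}.
Variables (a b : R) (mu : probability (measurableTypeR R) R).

Definition quad n (X : 'I_n -> R) (w : 'cV[R]_n) (h : R -> R) : R :=
  \sum_(i < n) w i 0 * h (X i).

Definition wce (S : inner_space R) n (X : 'I_n -> R) (w : 'cV[R]_n) : R :=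
  sup [set `|\int[mu]_(x in `[a, b]) h x - quad X w h|
      | h in [set h | carrier S h /\ inner_norm S h <= 1]].

Definition gram (k : R -> R -> R) n (X : 'I_n -> R) : 'M[R]_n :=
  \matrix_(i, j) k (X i) (X j).

(* The weights w^*: the unique minimizer of the worst-case error. *)
Definition optimal_weights (S : inner_space R) n (X : 'I_n -> R)
    (w : 'cV[R]_n) :=
  (forall v, wce S X w <= wce S X v) /\
  (forall w', (forall v, wce S X w' <= wce S X v) -> w' = w).

Definition positive_exact (phi : nat -> R -> R) n (X : 'I_n -> R)
    (w : 'cV[R]_n) :=
  [/\ forall i, X i \in `[a, b], forall i, 0 < w i 0 &
      forall m, (m <= (2 * n).-1)%N ->
        \int[mu]_(x in `[a, b]) phi m x = quad X w (phi m)].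

(* Uniqueness of a quadrature is up to the numbering of its nodes. *)
Definition poincare_quadrature (phi : nat -> R -> R) n (X : 'I_n -> R)
    (w : 'cV[R]_n) :=
  positive_exact phi X w /\
  forall X' w', positive_exact phi X' w' ->
    exists s : {perm 'I_n}, forall i, X' i = X (s i) /\ w' i 0 = w (s i) 0.

End Quadrature.

(* Main.v *)
Require Import Defs.
From mathcomp Require Import all_boot all_order all_algebra all_fingroup.
From mathcomp Require Import all_classical all_reals all_analysis.
From mathcomp Require Import measurable_realfun ring lra.
Import Order.TTheory GRing.Theory Num.Theory.
Import numFieldNormedType.Exports.
Local Open Scope classical_set_scope.
Local Open Scope ring_scope.

(** In a reproducing kernel Hilbert space in which the constant function 1
    represents the integral, the quadrature error is the inner product with
    err w = 1 - sum_i w_i k(X_i, .), so the squared worst-case error is the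
    quadratic polynomial 1 - 2 sum_i w_i + w^T k(X, X) w. When the Gram matrix
    is positive definite, completing the square gives the weights
    k(X, X)^-1 1 and the error 1 - sum_i w_i (optimal_weights_gram). In H^1 the
    function 1 represents the integral because it has no Dirichlet energy; in
    the space of K_M because h = sum_m alpha_m <h, phi_m> phi_m on [a, b],
    where only phi_0 = 1 has a nonzero integral and alpha_0 = 1. For the
    Poincare quadrature, exactness gives K_M(X, X) w = 1 directly, and its
    nodes are distinct because weight could otherwise be moved between
    coinciding nodes, against uniqueness.

    The Gram matrix is definite as soon as the functions of the space separate
    the nodes: no nontrivial combination of the n point evaluations vanishes on
    the space. In all three cases this follows from the Chebyshev property of
    phi_0, ..., phi_(n-1): a nontrivial combination of them has fewer than n
    zeros in [a, b] (chebyshev). The proof is that of Sturm and Liouville.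
    - Regularity (eigen_regular). An eigenfunction f is C^1 inside ]a, b[ and
      its flux P = - rho f' satisfies P' = lam rho f, P(a) = P(b) = 0.
    - Zeros (flux_zeros). By Rolle and the boundary conditions, applying the
      operator sum_m c_m phi_m |-> sum_m c_m lam_m phi_m loses no zeros.
      Iterating and rescaling, the top eigenfunction phi_p remains in the
      limit, and the zeros stay distinct in the limit since phi_p and its flux
      have no common zero (zeros_top, unique_continuation). So phi_p has as
      many zeros as the combination.
    - Nodal bound (courant). By Courant's variational argument phi_p has at
      most p zeros; it rests on the completeness of the basis (rayleigh_eq) and
      on the nodal pieces of phi_p being elements of H^1.

    The analytic foundation is the fundamental theorem of calculus for weak
    derivatives (weak_FTC), obtained by testing with plateau functions, and its
    consequence, integration by parts with C^1 factors (weak_IBP). *)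

Set Implicit Arguments.
Unset Strict Implicit.
Unset Printing Implicit Defensive.

(** * Kernel quadrature in spaces with a semidefinite form *)

Lemma lincombE {R : realType} I (r : seq I) (P : pred I) (c : I -> R)
    (F : I -> R -> R) x :
  (\sum_(i <- r | P i) c i *: F i) x = \sum_(i <- r | P i) c i * F i x.
Proof.
elim: r => [|i r IH]; first by rewrite !big_nil.
by rewrite !big_cons; case: (P i) => //; rewrite -IH.
Qed.

Section PreHilbert.
Context {R : realType}.
Implicit Types (S : inner_space R) (f g h : R -> R).

(** Positive semidefinite symmetric forms on a space of functions: the inner
    products of L^2 and of H^1, the Dirichlet form, and the inner product of
    any reproducing kernel Hilbert space are instances. *)
Definition is_prehilbert S :=
  [/\ carrier S 0,
      forall (k : R) f g, carrier S f -> carrier S g -> carrier S (k *: f + g),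
      forall (k : R) f g h, carrier S f -> carrier S g -> carrier S h ->
        inner S (k *: f + g) h = k * inner S f h + inner S g h,
      forall f g, carrier S f -> carrier S g -> inner S f g = inner S g f &
      forall f, carrier S f -> 0 <= inner S f f].

Variable S : inner_space R.
Hypothesis HS : is_prehilbert S.

Lemma carrier0 : carrier S 0. Proof. by case: HS. Qed.

Lemma carrier_lin (k : R) f g :
  carrier S f -> carrier S g -> carrier S (k *: f + g).
Proof. by case: HS => _ + _ _ _; exact. Qed.

Lemma carrierZ (k : R) f : carrier S f -> carrier S (k *: f).
Proof. by move=> Sf; rewrite -[_ *: _]addr0; apply: carrier_lin => //; exact: carrier0. Qed.

Lemma carrierB f g : carrier S f -> carrier S g -> carrier S (f - g).
Proof. by move=> Sf Sg; rewrite addrC -scaleN1r; exact: carrier_lin. Qed.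

Lemma carrier_sum I (r : seq I) (P : pred I) (c : I -> R) (F : I -> R -> R) :
  (forall i, carrier S (F i)) -> carrier S (\sum_(i <- r | P i) c i *: F i).
Proof.
move=> SF; elim/big_rec: _ => [|i y _ Sy]; first exact: carrier0.
exact: carrier_lin.
Qed.

Lemma inner_sym f g : carrier S f -> carrier S g -> inner S f g = inner S g f.
Proof. by case: HS => _ _ _ + _; exact. Qed.

Lemma inner_ge0 f : carrier S f -> 0 <= inner S f f.
Proof. by case: HS => _ _ _ _; exact. Qed.

Lemma inner_linl (k : R) f g h : carrier S f -> carrier S g -> carrier S h ->
  inner S (k *: f + g) h = k * inner S f h + inner S g h.
Proof. by case: HS => _ _ + _ _; exact. Qed.

Lemma inner0l h : carrier S h -> inner S 0 h = 0.
Proof.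
move=> Sh; have := inner_linl (-1) carrier0 carrier0 Sh.
by rewrite scaler0 addr0 mulN1r addNr.
Qed.

Lemma inner_linr (k : R) f g h : carrier S f -> carrier S g -> carrier S h ->
  inner S h (k *: f + g) = k * inner S h f + inner S h g.
Proof.
move=> Sf Sg Sh; rewrite inner_sym ?inner_linl//; last exact: carrier_lin.
by rewrite inner_sym// [inner S g h]inner_sym.
Qed.

Lemma innerZl (k : R) f h : carrier S f -> carrier S h ->
  inner S (k *: f) h = k * inner S f h.
Proof.
move=> Sf Sh; rewrite -[_ *: _]addr0 inner_linl ?inner0l ?addr0//.
exact: carrier0.
Qed.

Lemma innerBl f g h : carrier S f -> carrier S g -> carrier S h ->
  inner S (f - g) h = inner S f h - inner S g h.
Proof.
by move=> Sf Sg Sh; rewrite addrC -scaleN1r inner_linl// mulN1r addrC.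
Qed.

Lemma inner_suml I (r : seq I) (P : pred I) (c : I -> R) (F : I -> R -> R) h :
  (forall i, carrier S (F i)) -> carrier S h ->
  inner S (\sum_(i <- r | P i) c i *: F i) h =
  \sum_(i <- r | P i) c i * inner S (F i) h.
Proof.
move=> SF Sh; elim: r => [|i r IH]; first by rewrite !big_nil inner0l.
rewrite !big_cons; case: (P i) => //.
by rewrite inner_linl ?IH//; exact: carrier_sum.
Qed.

Lemma inner_sumr I (r : seq I) (P : pred I) (c : I -> R) (F : I -> R -> R) h :
  (forall i, carrier S (F i)) -> carrier S h ->
  inner S h (\sum_(i <- r | P i) c i *: F i) =
  \sum_(i <- r | P i) c i * inner S h (F i).
Proof.
move=> SF Sh; rewrite inner_sym//; last exact: carrier_sum.
by rewrite inner_suml//; apply: eq_bigr => i _; rewrite inner_sym.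
Qed.

Lemma cauchy_schwarz f g : carrier S f -> carrier S g ->
  inner S f g ^+ 2 <= inner S f f * inner S g g.
Proof.
move=> Sf Sg; set A := inner S f f; set B := inner S f g; set C := inner S g g.
have A0 : 0 <= A by exact: inner_ge0.
have C0 : 0 <= C by exact: inner_ge0.
have q (t : R) : 0 <= t ^+ 2 * A + 2 * t * B + C.
  have := inner_ge0 (carrier_lin t Sf Sg).
  rewrite inner_linr ?inner_linl//; last exact: carrier_lin.
  by rewrite (inner_sym Sg Sf) -/A -/B -/C; nra.
have := A0; rewrite le_eqVlt => /predU1P[A00|Apos].
  suff -> : B = 0 by rewrite expr0n/= mulr_ge0.
  apply/eqP/negPn/negP => B0.
  (* The form is affine in t here; at this t it would be -1. *)
  have := q (- (C + 1) / (2 * B)); rewrite -A00 mulr0 add0r.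
  rewrite (_ : 2 * (- (C + 1) / (2 * B)) * B = - (C + 1)); first lra.
  by field.
(* The minimum of the quadratic. *)
have := q (- B / A).
have -> : (- B / A) ^+ 2 * A + 2 * (- B / A) * B + C = C - B ^+ 2 / A.
  by field; rewrite gt_eqF.
by rewrite subr_ge0 ler_pdivrMr// mulrC.
Qed.

Lemma cauchy_schwarz_norm f g : carrier S f -> carrier S g ->
  `|inner S f g| <= inner_norm S f * inner_norm S g.
Proof.
move=> Sf Sg; rewrite -ler_sqr ?nnegrE ?mulr_ge0 ?sqrtr_ge0//.
by rewrite exprMn !sqr_sqrtr ?inner_ge0// real_normK ?num_real// cauchy_schwarz.
Qed.

End PreHilbert.

Lemma unitmx_definite {F : fieldType} n (G : 'M[F]_n) :
  (forall v : 'cV_n, (v^T *m G *m v) 0 0 = 0 -> v = 0) -> G \in unitmx.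
Proof.
move=> G0; rewrite -row_free_unit -kermx_eq0; apply/eqP/row_matrixP => i.
have : row i (kermx G) *m G = 0 by rewrite -row_mul mulmx_ker row0.
rewrite row0; move: (row i _) => v vG.
apply: trmx_inj; rewrite trmx0; apply: G0.
by rewrite trmxK vG mul0mx mxE.
Qed.

Section KernelQuadrature.
Context {R : realType}.
Variables (a b : R) (mu : probability (measurableTypeR R) R).
Variables (S : inner_space R) (k : R -> R -> R) (e : R -> R).
Hypothesis HS : is_prehilbert S.
Hypothesis Hk : reproducing_kernel `[a, b] S k.
Hypothesis Se : carrier S e.
Hypothesis e1 : forall x, x \in `[a, b] -> e x = 1.
Hypothesis inte : inner S e e = 1.
Hypothesis int_e : forall h, carrier S h ->
  \int[mu]_(x in `[a, b]) h x = inner S h e.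
Variables (n : nat) (X : 'I_n -> R).
Hypothesis XI : forall i, X i \in `[a, b].

Let kS i : carrier S (k (X i)). Proof. by case: (Hk (XI i)). Qed.

Let kE i f : carrier S f -> inner S f (k (X i)) = f (X i).
Proof. by case: (Hk (XI i)) => _; exact. Qed.

Let err (w : 'cV[R]_n) : R -> R := e - \sum_i w i 0 *: k (X i).

Let err_carrier w : carrier S (err w).
Proof. by apply: carrierB => //; exact: carrier_sum. Qed.

(** Both the integral (represented by e) and the point evaluations
    (represented by the kernel) are inner products, hence so is the quadrature
    error. *)
Lemma quad_errE (w : 'cV[R]_n) h : carrier S h ->
  \int[mu]_(x in `[a, b]) h x - quad X w h = inner S h (err w).
Proof.
move=> Sh; rewrite int_e// (inner_sym HS Sh (err_carrier w)) innerBl//; last exact: carrier_sum.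
rewrite (inner_sym HS Se Sh) inner_suml//; congr (_ - _).
by apply: eq_bigr => i _; rewrite (inner_sym HS (kS i) Sh) kE.
Qed.

(** Cauchy-Schwarz bounds the error over the unit ball by the norm of err w,
    and the normalized err w attains this bound. *)
Lemma wceE (w : 'cV[R]_n) : wce a b mu S X w = inner_norm S (err w).
Proof.
rewrite /wce; set V := [set _ | _ in _].
have ub : ubound V (inner_norm S (err w)).
  move=> _ [h [Sh hle] <-]; rewrite quad_errE//.
  apply: le_trans (cauchy_schwarz_norm HS Sh (err_carrier w)) _.
  by rewrite ler_piMl// sqrtr_ge0.
have Verr : V (inner_norm S (err w)).
  have [r0|rneq] := eqVneq (inner_norm S (err w)) 0.
    exists 0; first by split; [exact: carrier0|rewrite /inner_norm inner0l ?sqrtr0//; exact: carrier0].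
    by rewrite quad_errE ?inner0l ?normr0//; exact: carrier0.
  set r := inner_norm S (err w) in rneq *.
  have r0 : 0 < r by rewrite lt_def rneq sqrtr_ge0.
  have r2 : inner S (err w) (err w) = r ^+ 2.
    by rewrite /r /inner_norm sqr_sqrtr// inner_ge0.
  have Sr : carrier S (r^-1 *: err w) by exact: carrierZ.
  exists (r^-1 *: err w); first split => //.
    rewrite /inner_norm innerZl// inner_sym// innerZl// r2.
    rewrite (_ : _ * _ = 1) ?sqrtr1//.
    by rewrite expr2 !mulrA -mulrA -invfM mulVf// mulf_neq0.
  rewrite quad_errE// innerZl// r2 expr2 mulrA mulVf// mul1r.
  by rewrite ger0_norm ?ltW.
apply/eqP; rewrite eq_le; apply/andP; split.
  by apply: ge_sup => //; exists (inner_norm S (err w)).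
by apply: ub_le_sup => //; exists (inner_norm S (err w)).
Qed.

Let ones : 'cV[R]_n := const_mx 1.

Lemma wce_sqr (w : 'cV[R]_n) :
  wce a b mu S X w ^+ 2 =
  1 - 2 * (ones^T *m w) 0 0 + (w^T *m gram k X *m w) 0 0.
Proof.
rewrite wceE sqr_sqrtr ?inner_ge0// -quad_errE//.
rewrite int_e// innerBl//; last exact: carrier_sum.
rewrite inte inner_suml//.
have ke i : inner S (k (X i)) e = 1.
  by rewrite inner_sym// kE// e1.
under eq_bigr do rewrite ke mulr1.
have -> : (ones^T *m w) 0 0 = \sum_i w i 0.
  by rewrite mxE; apply: eq_bigr => i _; rewrite !mxE mul1r.
have -> : quad X w (err w) = \sum_i w i 0 - (w^T *m gram k X *m w) 0 0.
  rewrite /quad [in RHS]mxE -sumrB; apply: eq_bigr => i _.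
  rewrite /err [(e - _) _]/(e _ - _) e1// mulrBr mulr1; congr (_ - _).
  rewrite lincombE mulrC; congr (_ * _); rewrite mxE.
  by apply: eq_bigr => j _; rewrite !mxE.
ring.
Qed.

Lemma gram_sym : (gram k X)^T = gram k X.
Proof.
apply/matrixP => i j; rewrite !mxE.
by rewrite -(kE i (kS j)) -(kE j (kS i)) inner_sym.
Qed.

Lemma gram_normE (v : 'cV[R]_n) : let f := \sum_i v i 0 *: k (X i) in
  (v^T *m gram k X *m v) 0 0 = inner S f f.
Proof.
move=> f; have Sf : carrier S f by exact: carrier_sum.
rewrite inner_sumr// mxE; apply: eq_bigr => i _.
rewrite kE// mulrC; congr (_ * _); rewrite mxE /f lincombE.
by apply: eq_bigr => j _; rewrite !mxE.
Qed.

Lemma gram_ge0 (v : 'cV[R]_n) : 0 <= (v^T *m gram k X *m v) 0 0.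
Proof. by rewrite gram_normE inner_ge0//; exact: carrier_sum. Qed.

Hypothesis sep : forall v : 'cV[R]_n,
  (forall h, carrier S h -> \sum_i v i 0 * h (X i) = 0) -> v = 0.

(** A null vector v of the Gram form gives a combination of the k (X i) of
    norm zero; by Cauchy-Schwarz it is orthogonal to the whole space, that is,
    sum_i v_i h(X_i) = 0 for every h. *)
Lemma gram_eq0 (v : 'cV[R]_n) : (v^T *m gram k X *m v) 0 0 = 0 -> v = 0.
Proof.
rewrite gram_normE; set f := \sum_i _ => ff0.
have Sf : carrier S f by exact: carrier_sum.
apply: sep => h Sh.
have := cauchy_schwarz HS Sf Sh; rewrite ff0 mul0r => hf.
have : inner S f h = 0.
  by apply/eqP; rewrite -sqrf_eq0 eq_le hf sqr_ge0.
rewrite inner_suml// => fh0; rewrite -[RHS]fh0; apply: eq_bigr => i _.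
by rewrite inner_sym// kE.
Qed.

Lemma gram_unit : gram k X \in unitmx.
Proof. exact: unitmx_definite gram_eq0. Qed.

(** Completing the square: since gram k X *m w = 1, the squared worst-case
    error at v exceeds the one at w by the Gram form of v - w. *)
Lemma optimal_weights_gram (w := invmx (gram k X) *m ones) :
  [/\ optimal_weights a b mu S X w,
      w = invmx (gram k X) *m ones,
      wce a b mu S X w ^+ 2 =
        1 - (ones^T *m invmx (gram k X) *m ones : 'M[R]_1) 0 0 &
      wce a b mu S X w ^+ 2 = 1 - \sum_(i < n) w i 0].
Proof.
have Gu := gram_unit.
have Gw : gram k X *m w = ones by rewrite /w mulKVmx.
have onesw : (ones^T *m w) 0 0 = \sum_i w i 0.
  by rewrite mxE; apply: eq_bigr => i _; rewrite !mxE mul1r.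
have wGE (v : 'cV_n) : w^T *m gram k X *m v = ones^T *m v.
  by rewrite -[in RHS]Gw (trmx_mul (gram k X)) gram_sym.
have s11 (A : 'M[R]_1) : A^T = A.
  by apply/matrixP => i j; rewrite mxE !ord1.
have wce_w : wce a b mu S X w ^+ 2 = 1 - \sum_i w i 0.
  by rewrite wce_sqr wGE onesw; ring.
have decomp v : wce a b mu S X v ^+ 2 = wce a b mu S X w ^+ 2 +
    ((v - w)^T *m gram k X *m (v - w)) 0 0.
  rewrite wce_w wce_sqr -onesw [(v - w)^T]linearB/=.
  rewrite !(mulmxBl, mulmxBr).
  have -> : v^T *m gram k X *m w = ones^T *m v.
    by rewrite -mulmxA Gw -[LHS]s11 trmx_mul trmxK.
  by rewrite !wGE !mxE; ring.
have wce0 v : 0 <= wce a b mu S X v by rewrite wceE sqrtr_ge0.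
split => //.
- split=> [v|w' /(_ w) w'le].
    by rewrite -ler_sqr ?nnegrE// (decomp v) lerDl gram_ge0.
  apply/eqP; rewrite -subr_eq0; apply/eqP/gram_eq0/eqP.
  rewrite eq_le gram_ge0 andbT.
  have := w'le; rewrite -ler_sqr ?nnegrE// (decomp w').
  by rewrite gerDl.
- by rewrite wce_w -onesw /w mulmxA.
Qed.

End KernelQuadrature.

(** * Piecewise quadratic transition functions *)

Section Tents.
Context {R : realType}.
Notation leb := (@lebesgue_measure R).
Implicit Types (f g : R -> R).

(** A remainder bounded by C h^2 gives differentiability without a case
    distinction at the knots of a spline. *)
Lemma is_derive_quadratic f (x l C : R) :
  (forall h, `|f (h + x) - f x - l * h| <= C * h ^+ 2) -> is_derive x 1 f l.
Proof.
move=> fl.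
have C0 : 0 <= C.
  by have /(le_trans (normr_ge0 _)) := fl 1; rewrite expr1n mulr1.
have lim : h^-1 *: ((f \o shift x) h%:A - f x) @[h --> 0^'] --> l.
  apply/cvgrPdist_le => e e0; near=> h.
  have h0 : h != 0 by near: h; exact: nbhs_dnbhs_neq.
  have -> : l - h^-1 *: ((f \o shift x) h%:A - f x) =
            - (h^-1 * (f (h + x) - f x - l * h)).
    by rewrite /= [h%:A]mulr1 /GRing.scale/=; field.
  rewrite normrN normrM normfV ler_pdivrMl ?normr_gt0//.
  apply: le_trans (fl h) _.
  rewrite -[h ^+ 2]real_normK ?num_real// expr2 mulrA mulrC ler_wpM2l//.
  have : `|h| <= e / (C + 1).
    by near: h; apply: dnbhs0_le; rewrite divr_gt0// ltr_wpDl.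
  rewrite ler_pdivlMr ?ltr_wpDl// => he.
  by apply: le_trans he; rewrite mulrC ler_wpM2l// lerDl.
split; first by apply/cvg_ex; exists l.
exact/cvg_lim.
Unshelve. all: by end_near. Qed.

Definition hinge (c x : R) : R := Num.max (x - c) 0.

Lemma hinge_le c x : x <= c -> hinge c x = 0.
Proof. by move=> xc; rewrite /hinge; apply/max_idPr; rewrite subr_le0. Qed.

Lemma hinge_ge c x : c <= x -> hinge c x = x - c.
Proof. by move=> xc; rewrite /hinge; apply/max_idPl; rewrite subr_ge0. Qed.

Lemma continuous_hinge c : continuous (hinge c).
Proof.
move=> x; apply: (@continuous_max _ _ (fun x => x - c) (fun=> 0)).
  by apply: cvgB; [exact: cvg_id|exact: cvg_cst].
exact: cvg_cst.
Qed.

Lemma is_derive_hinge_sqr (c x : R) :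
  is_derive x 1 (fun y => hinge c y ^+ 2) (2 * hinge c x).
Proof.
apply: (@is_derive_quadratic _ _ _ 1) => h; rewrite mul1r ler_norml.
have [hc|/ltW hc] := leP (h + x) c; have [xc|/ltW xc] := leP x c.
- by rewrite !hinge_le//; apply/andP; split; nra.
- by rewrite hinge_le// hinge_ge//; apply/andP; split; nra.
- by rewrite hinge_ge// hinge_le//; apply/andP; split; nra.
- by rewrite !hinge_ge//; apply/andP; split; nra.
Qed.

(** The piecewise quadratic C^1 transition from 0 to 1 over [s, s + e], written
    as a second difference of squared hinges; tent is its derivative, a hat of
    unit mass on [s, s + e]. *)
Definition ramp (s e x : R) : R :=
  2 / e ^+ 2 * (hinge s x ^+ 2 - 2 * hinge (s + e / 2) x ^+ 2
                + hinge (s + e) x ^+ 2).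

Definition tent (s e x : R) : R :=
  4 / e ^+ 2 * (hinge s x - 2 * hinge (s + e / 2) x + hinge (s + e) x).

Lemma continuous_tent s e : continuous (tent s e).
Proof.
move=> x; apply: cvgM; first exact: cvg_cst.
apply: cvgD; last exact: continuous_hinge.
apply: cvgB; first exact: continuous_hinge.
by apply: cvgM; [exact: cvg_cst|exact: continuous_hinge].
Qed.

Lemma is_derive_ramp (s e x : R) : is_derive x 1 (ramp s e) (tent s e x).
Proof.
have d1 := is_derive_hinge_sqr s x.
have d2 := is_derive_hinge_sqr (s + e / 2) x.
have d3 := is_derive_hinge_sqr (s + e) x.
pose F := 2 / e ^+ 2 \*: ((fun y => hinge s y ^+ 2) - 2 \*: (fun y => hinge (s + e / 2) y ^+ 2)
                + (fun y => hinge (s + e) y ^+ 2)).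
have -> : ramp s e = F by [].
rewrite /F; apply: is_derive_eq.
by rewrite /tent /GRing.scale/=; ring.
Qed.

Lemma ramp_le (s e x : R) : 0 < e -> x <= s -> ramp s e x = 0.
Proof.
by move=> e0 xs; rewrite /ramp !hinge_le; [rewrite expr0n/=; ring|lra..].
Qed.

Lemma tent_le (s e x : R) : 0 < e -> x <= s -> tent s e x = 0.
Proof. by move=> e0 xs; rewrite /tent !hinge_le; [ring|lra..]. Qed.

Lemma ramp_ge (s e x : R) : 0 < e -> s + e <= x -> ramp s e x = 1.
Proof.
by move=> e0 xs; rewrite /ramp !hinge_ge; [field; rewrite gt_eqF|lra..].
Qed.

Lemma tent_ge (s e x : R) : 0 < e -> s + e <= x -> tent s e x = 0.
Proof.
by move=> e0 xs; rewrite /tent !hinge_ge; [field; rewrite gt_eqF|lra..].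
Qed.

Lemma tent_ge0 (s e x : R) : 0 < e -> 0 <= tent s e x.
Proof.
move=> e0.
have [xs|/ltW sx] := leP x s; first by rewrite tent_le.
have [xs|/ltW xs] := leP (s + e) x; first by rewrite tent_ge.
apply: mulr_ge0; first by rewrite divr_ge0// exprn_ge0// ltW.
rewrite (@hinge_ge s)// (@hinge_le (s + e))//.
have [xm|/ltW xm] := leP x (s + e / 2); first by rewrite hinge_le//; lra.
by rewrite hinge_ge//; lra.
Qed.

Lemma ramp_itv (s e x : R) : 0 < e -> 0 <= ramp s e x <= 1.
Proof.
move=> e0.
have inc : {in `[s, (s + e)]%R &, {homo ramp s e : x y / x <= y}}.
  apply: ger0_derive1_le_cc => [y _|y _|].
  - by have [] := is_derive_ramp s e y.
  - by rewrite derive1E; have [_ ->] := is_derive_ramp s e y; exact: tent_ge0.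
  - apply: derivable_within_continuous => y _.
    by have [] := is_derive_ramp s e y.
have [xs|/ltW sx] := leP x s; first by rewrite ramp_le// lexx ler01.
have [xs|/ltW xs] := leP (s + e) x; first by rewrite ramp_ge// ler01 lexx.
have se : s <= s + e by rewrite lerDl ltW.
apply/andP; split.
  rewrite -(ramp_le e0 (lexx s)); apply: inc => //; rewrite in_itv/= ?lexx ?se//.
  by rewrite sx xs.
rewrite -[leRHS](ramp_ge e0 (lexx (s + e))); apply: inc => //.
  by rewrite in_itv/= sx xs.
by rewrite in_itv/= lexx se.
Qed.

Lemma integral_tent (s e c d : R) : 0 < e -> c <= s -> s + e <= d ->
  \int[leb]_(x in `[c, d]) tent s e x = 1.
Proof.
move=> e0 cs sd; have cd : c < d by lra.
rewrite /Rintegral (@continuous_FTC2 _ _ (ramp s e))//.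
- by rewrite -EFinB/= ramp_ge// ramp_le// subr0.
- exact/continuous_subspaceT/continuous_tent.
- split=> [x _||].
  + by have [] := is_derive_ramp s e x.
  + apply: cvg_at_right_filter; apply: differentiable_continuous.
    by apply/derivable1_diffP; have [] := is_derive_ramp s e c.
  + apply: cvg_at_left_filter; apply: differentiable_continuous.
    by apply/derivable1_diffP; have [] := is_derive_ramp s e d.
- by move=> x _; rewrite derive1E; have [] := is_derive_ramp s e x.
Qed.

Lemma within_continuous_integrable f c d :
  {within `[c, d], continuous f} -> leb.-integrable `[c, d] (EFin \o f).
Proof.
by move=> cf; apply: continuous_compact_integrable => //; exact: segment_compact.
Qed.

(** Integrating against tent s e averages f over [s, s + e]. *)
Lemma tent_average f (s e c d v eta : R) : 0 < e -> c <= s -> s + e <= d ->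
  {within `[c, d], continuous f} ->
  (forall x, s <= x <= s + e -> `|v - f x| <= eta) ->
  `|v - \int[leb]_(x in `[c, d]) (f x * tent s e x)| <= eta.
Proof.
move=> e0 cs sd cf fv.
have ctent : {within `[c, d], continuous (tent s e)}.
  exact/continuous_subspaceT/continuous_tent.
have ift : leb.-integrable `[c, d] (EFin \o (fun x => f x * tent s e x)).
  apply: within_continuous_integrable => x.
  by apply: cvgM; [exact: cf|exact: ctent].
have ict k : leb.-integrable `[c, d] (EFin \o (fun x => k * tent s e x)).
  apply: within_continuous_integrable => x.
  by apply: cvgM; [exact: cvg_cst|exact: ctent].
have kE k : k = \int[leb]_(x in `[c, d]) (k * tent s e x).
  rewrite RintegralZl ?integral_tent ?mulr1//.
  exact: within_continuous_integrable.
have fx x : `|v - f x| <= eta \/ tent s e x = 0.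
  have [xs|/ltW sx] := leP x s; first by right; rewrite tent_le.
  have [xs|/ltW xs] := leP (s + e) x; first by right; rewrite tent_ge.
  by left; apply: fv; rewrite sx xs.
have lo : v - eta <= \int[leb]_(x in `[c, d]) (f x * tent s e x).
  rewrite [leLHS]kE; apply: le_Rintegral => // x _.
  have := tent_ge0 s x e0; case: (fx x) => [|->]; last by rewrite !mulr0.
  by rewrite ler_norml => /andP[? ?] ?; nra.
have hi : \int[leb]_(x in `[c, d]) (f x * tent s e x) <= v + eta.
  rewrite [leRHS]kE; apply: le_Rintegral => // x _.
  have := tent_ge0 s x e0; case: (fx x) => [|->]; last by rewrite !mulr0.
  by rewrite ler_norml => /andP[? ?] ?; nra.
by rewrite ler_norml; apply/andP; split; lra.
Qed.

Lemma within_cont_dist f (A : set R) x eta : {within A, continuous f} -> A x ->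
  0 < eta -> exists2 delta, 0 < delta &
    forall y, A y -> `|x - y| < delta -> `|f x - f y| <= eta.
Proof.
move=> /subspace_continuousP cf Ax eta0.
have /cvgrPdist_le/(_ _ eta0) := cf _ Ax.
rewrite /within/= => /nbhs_ballP[delta/= d0 H]; exists delta => //.
by move=> y Ay xy; apply: H.
Qed.

End Tents.

(** * The fundamental theorem for weak derivatives *)

Section WeakFTC.
Context {R : realType}.
Notation leb := (@lebesgue_measure R).
Implicit Types (f g : R -> R).

Lemma Rintegral_supp (D E : set R) (h : R -> R) :
  (forall x, D x -> ~ E x -> h x = 0) -> (forall x, E x -> ~ D x -> h x = 0) ->
  \int[leb]_(x in D) h x = \int[leb]_(x in E) h x.
Proof.
move=> DE ED; rewrite Rintegral_mkcond [RHS]Rintegral_mkcond.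
congr (Rintegral _ _ _); apply/funext => x; rewrite !patchE.
have [Dx|Dx] := pselect (D x); have [Ex|Ex] := pselect (E x);
  rewrite ?(mem_set Dx) ?(mem_set Ex) ?(memNset Dx) ?(memNset Ex) //.
  exact: DE.
by rewrite ED.
Qed.

Lemma Rintegral_itv_oo_cc f (c d : R) :
  leb.-integrable `[c, d] (EFin \o f) ->
  \int[leb]_(x in `]c, d[) f x = \int[leb]_(x in `[c, d]) f x.
Proof.
move=> intf; rewrite Rintegral_itv_bndo_bndc ?Rintegral_itv_obnd_cbnd//.
  by apply: integrableS intf => //; apply: subset_itvr; rewrite bnd_simp.
apply: integrableS intf => //; exact: subset_itv_oo_cc.
Qed.

(** Rises on [c + e, c + 2 e] and falls on [d - 2 e, d - e]: its support stays
    inside ]c, d[, so it is a test function even when c = a or d = b. *)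
Definition plateau (c d e x : R) : R := ramp (c + e) e x - ramp (d - 2 * e) e x.

Lemma is_derive_plateau (c d e x : R) :
  is_derive x 1 (plateau c d e) (tent (c + e) e x - tent (d - 2 * e) e x).
Proof.
have d1 := is_derive_ramp (c + e) e x.
have d2 := is_derive_ramp (d - 2 * e) e x.
exact: is_deriveB.
Qed.

Lemma derive1_plateau (c d e : R) :
  derive1 (plateau c d e) = fun x => tent (c + e) e x - tent (d - 2 * e) e x.
Proof.
apply/funext => x; rewrite derive1E.
by have [] := is_derive_plateau c d e x.
Qed.

Lemma plateau_out (c d e x : R) : 0 < e -> 4 * e <= d - c ->
  x <= c + e \/ d - e <= x -> plateau c d e x = 0.
Proof.
move=> e0 ed [xc|xd]; rewrite /plateau.
  by rewrite !ramp_le ?subrr//; lra.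
by rewrite !ramp_ge ?subrr//; lra.
Qed.

Lemma plateau_in (c d e x : R) : 0 < e -> c + 2 * e <= x <= d - 2 * e ->
  plateau c d e x = 1.
Proof.
move=> e0 /andP[cx xd]; rewrite /plateau ramp_ge; [|lra..].
by rewrite ramp_le ?subr0.
Qed.

Lemma plateau_norm (c d e x : R) : 0 < e -> `|plateau c d e x| <= 1.
Proof.
move=> e0; have := ramp_itv (c + e) x e0; have := ramp_itv (d - 2 * e) x e0.
by move=> /andP[? ?] /andP[? ?]; rewrite /plateau ler_norml; apply/andP; split; lra.
Qed.

Lemma continuous_plateau (c d e : R) : continuous (plateau c d e).
Proof.
move=> x; apply: differentiable_continuous; apply/derivable1_diffP.
by have [] := is_derive_plateau c d e x.
Qed.

Lemma test_plateau (a b c d e : R) : a <= c -> d <= b -> 0 < e ->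
  4 * e <= d - c -> test_function a b (plateau c d e).
Proof.
move=> ac db e0 ed; split.
- by move=> x; have [] := is_derive_plateau c d e x.
- rewrite derive1_plateau => x.
  by apply: cvgB; exact: continuous_tent.
- exists (c + e), (d - e); split; [lra|lra|move=> x].
  rewrite in_itv/= negb_and -!ltNge => /orP[|] /ltW ?; apply: plateau_out => //.
    by left.
  by right.
Qed.

(** The integral identity of a weak derivative, separated from local
    integrability. *)
Definition weak_ibp (a b : R) f g := forall phi, test_function a b phi ->
  \int[leb]_(x in `]a, b[) (f x * derive1 phi x) =
  - \int[leb]_(x in `]a, b[) (g x * phi x).

(** Testing against plateau functions that increase to the indicator of [c, d]:
    their derivatives are a unit bump at c minus a unit bump at d. *)
Lemma weak_FTC (a b c d : R) f g : a <= c -> c < d -> d <= b ->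
  {within `[c, d], continuous f} -> leb.-integrable `[c, d] (EFin \o g) ->
  weak_ibp a b f g -> f d - f c = \int[leb]_(x in `[c, d]) g x.
Proof.
move=> ac cd db cf ig wfg.
(* 4 e n <= d - c keeps the rise and the fall of the plateau apart. *)
pose e (n : nat) := (d - c) / (4 * n.+1%:R).
have e0 n : 0 < e n by rewrite divr_gt0 ?subr_gt0// mulr_gt0.
have e4 n : 4 * e n <= d - c.
  rewrite mulrC -mulrA ler_piMr ?subr_ge0 ?(ltW cd)//.
  by rewrite invfM mulrAC mulVf// mul1r invf_le1// ler1n.
have ecvg : e n @[n --> \oo] --> 0.
  rewrite -(mulr0 ((d - c) / 4)).
  have -> : e = (fun n => (d - c) / 4 * harmonic n).
    by apply/funext => n; rewrite /e /harmonic/= invfM mulrA.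
  by apply: cvgM; [exact: cvg_cst|exact: cvg_harmonic].
have inout x : (x \in `]a, b[) <> (x \in `[c, d]) -> x <= c \/ d <= x.
  case: (leP x c) => [|cx]; first by left.
  case: (leP d x) => [|xd]; first by right.
  by rewrite !in_itv/= (le_lt_trans ac cx) (lt_le_trans xd db) !ltW.
have psi0 n x : x <= c \/ d <= x -> plateau c d (e n) x = 0.
  have := e0 n; have := e4 n => ? ? H; apply: plateau_out => //.
  by case: H => ?; [left|right]; lra.
have psi'0 n x : x <= c \/ d <= x -> derive1 (plateau c d (e n)) x = 0.
  have := e0 n; have := e4 n => ? ? H; rewrite derive1_plateau.
  case: H => ?; [rewrite !tent_le ?subrr|rewrite !tent_ge ?subrr] => //; lra.
have wfgn n : \int[leb]_(x in `[c, d]) (f x * tent (c + e n) (e n) x) -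
   \int[leb]_(x in `[c, d]) (f x * tent (d - 2 * e n) (e n) x) =
   - \int[leb]_(x in `[c, d]) (g x * plateau c d (e n) x).
  have := wfg _ (test_plateau ac db (e0 n) (e4 n)).
  rewrite (@Rintegral_supp `]a, b[ `[c, d]); last first.
  - move=> x /= xcd xab; rewrite psi'0 ?mulr0//; apply: inout.
    by rewrite xcd => /xab.
  - move=> x /= xab xcd; rewrite psi'0 ?mulr0//; apply: inout.
    by rewrite xab => /esym/xcd.
  rewrite (@Rintegral_supp `]a, b[ `[c, d] (fun x => g x * _)); last first.
  - move=> x /= xcd xab; rewrite psi0 ?mulr0//; apply: inout.
    by rewrite xcd => /xab.
  - move=> x /= xab xcd; rewrite psi0 ?mulr0//; apply: inout.
    by rewrite xab => /esym/xcd.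
  move=> <-; rewrite derive1_plateau -RintegralB//; last 2 first.
  - apply: within_continuous_integrable => x.
    by apply: cvgM; [exact: cf|exact/continuous_subspaceT/continuous_tent].
  - apply: within_continuous_integrable => x.
    by apply: cvgM; [exact: cf|exact/continuous_subspaceT/continuous_tent].
  by apply: eq_Rintegral => x _; rewrite mulrBr.
have cvg_c : (\int[leb]_(x in `[c, d]) (f x * tent (c + e n) (e n) x))
    @[n --> \oo] --> f c.
  apply/cvgrPdist_le => eta eta0.
  have cin : `[c, d]%classic c by rewrite /= in_itv/= lexx ltW.
  have [delta d0 fcx] := within_cont_dist cf cin eta0.
  have : \forall n \near \oo, e n < delta / 2.
    by apply: (cvgr_lt 0) => //; rewrite divr_gt0.
  apply: filterS => n en; have := e0 n; have := e4 n => e4n e0n.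
  apply: tent_average => //; [lra|lra|move=> x /andP[x1 x2]].
  apply: fcx; first by rewrite /= in_itv/=; apply/andP; split; lra.
  by rewrite ltr_norml; apply/andP; split; lra.
have cvg_d : (\int[leb]_(x in `[c, d]) (f x * tent (d - 2 * e n) (e n) x))
    @[n --> \oo] --> f d.
  apply/cvgrPdist_le => eta eta0.
  have din : `[c, d]%classic d by rewrite /= in_itv/= lexx ltW.
  have [delta d0 fcx] := within_cont_dist cf din eta0.
  have : \forall n \near \oo, e n < delta / 2.
    by apply: (cvgr_lt 0) => //; rewrite divr_gt0.
  apply: filterS => n en; have := e0 n; have := e4 n => e4n e0n.
  apply: tent_average => //; [lra|lra|move=> x /andP[x1 x2]].
  apply: fcx; first by rewrite /= in_itv/=; apply/andP; split; lra.
  by rewrite ltr_norml; apply/andP; split; lra.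
have mg : measurable_fun `[c, d] g by case/integrableP: (ig) => /measurable_EFinP.
have mgp n : measurable_fun `[c, d] (fun x => g x * plateau c d (e n) x).
  apply: measurable_funM => //; apply: measurable_funTS.
  by apply: continuous_measurable_fun; exact: continuous_plateau.
have igp n : leb.-integrable `[c, d]
    (EFin \o (fun x => g x * plateau c d (e n) x)).
  apply: le_integrable ig => //; first by apply/measurable_EFinP; exact: mgp.
  move=> x _ /=; rewrite lee_fin normrM ler_piMr//; exact: plateau_norm.
have mgoo : measurable_fun `[c, d] (g \_ `]c, d[).
  by apply/measurable_restrict => //; apply: measurable_funS mg.
have cvg_g : (\int[leb]_(x in `[c, d]) (g x * plateau c d (e n) x))
    @[n --> \oo] --> \int[leb]_(x in `[c, d]) g x.
  have [|||||igoo _ cvg_e] := @dominated_convergence _ _ R leb `[c, d] (measurable_itv _)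
    (fun n x => (g x * plateau c d (e n) x)%:E) (EFin \o (g \_ `]c, d[))
    (fun x => `|g x|%:E).
  - by move=> n; apply/measurable_EFinP; exact: mgp.
  - exact/measurable_EFinP.
  - apply: aeW => x /= xcd; apply: cvg_EFin; first exact: nearW.
    have [xoo|xoo] := boolP ((x : R) \in `]c, d[); last first.
      rewrite patchE memNset; last exact/negP.
      have x01 : x <= c \/ d <= x.
        by move: xoo; rewrite in_itv/= negb_and -!leNgt => /orP[]; [left|right].
      under eq_fun do rewrite /= psi0// mulr0; exact: cvg_cst.
    rewrite patchE mem_set//.
    rewrite -[X in _ --> X]mulr1; apply: cvgM; first exact: cvg_cst.
    move: xoo; rewrite in_itv/= => /andP[cx xd].
    have : \forall n \near \oo, e n < Num.min (x - c) (d - x) / 2.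
      by apply: (cvgr_lt 0) => //; rewrite divr_gt0// lt_min !subr_gt0 cx xd.
    move=> en; apply: cvg_near_cst; apply: filterS en => n en.
    have := e0 n => e0n; apply: plateau_in => //; move: en.
    rewrite ltr_pdivlMr// lt_min => /andP[? ?]; apply/andP; split; lra.
  - exact: integrable_norm.
  - apply: aeW => x n _ /=; rewrite lee_fin normrM ler_piMr//.
    exact: plateau_norm.
  have goo : \int[leb]_(x in `[c, d]) g x = \int[leb]_(x in `[c, d]) (g \_ `]c, d[) x.
    rewrite -Rintegral_mkcondr setIidr; last exact: subset_itv_oo_cc.
    exact/esym/Rintegral_itv_oo_cc.
  rewrite goo; apply: fine_cvg; rewrite fineK//.
  apply: integrable_fin_num => //.
have lim1 : - (\int[leb]_(x in `[c, d]) (g x * plateau c d (e n) x))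
    @[n --> \oo] --> f c - f d.
  by under eq_fun do rewrite -wfgn; exact: cvgB.
have : f c - f d = - \int[leb]_(x in `[c, d]) g x.
  by apply: (cvg_unique _ lim1) => //; exact: cvgN.
by move=> /(congr1 -%R); rewrite opprB opprK.
Qed.

End WeakFTC.

(** * Integration by parts *)

Section WeakIBP.
Context {R : realType}.
Notation leb := (@lebesgue_measure R).
Implicit Types (f g P p : R -> R).

Lemma within_continuousM (A : set R) f g :
  {within A, continuous f} -> {within A, continuous g} ->
  {within A, continuous (fun x => f x * g x)}.
Proof. by move=> cf cg x; apply: cvgM; [exact: cf|exact: cg]. Qed.

Lemma within_continuousD (A : set R) f g :
  {within A, continuous f} -> {within A, continuous g} ->
  {within A, continuous (fun x => f x + g x)}.
Proof. by move=> cf cg x; apply: cvgD; [exact: cf|exact: cg]. Qed.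

Lemma integrable_mul_continuous (a b : R) f g :
  leb.-integrable `[a, b] (EFin \o f) -> {within `[a, b], continuous g} ->
  leb.-integrable `[a, b] (EFin \o (fun x => f x * g x)).
Proof.
move=> intf cg.
have mg : measurable_fun `[a, b] g.
  exact: subspace_continuous_measurable_fun.
have bg : [bounded g x | x in `[a, b]].
  have /compact_bounded[M [_ Mv]] : compact (g @` `[a, b]).
    by apply: continuous_compact => //; exact: segment_compact.
  by exists M; split; rewrite ?num_real // => ? ? ? ?; exact: Mv.
have := @integrableMl _ _ R leb `[a, b] (measurable_itv _) _ _ intf mg bg.
exact.
Qed.

Lemma derive_near0 f (x : R) : (\forall y \near x, f y = 0) -> 'D_1 f x = 0.
Proof.
move=> f0; have [] // : is_derive x 1 f 0.
by apply: (near_eq_is_derive (f := cst 0)); apply: filterS f0.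
Qed.

Lemma near_out_itv_cc (c d x : R) : x \notin `[c, d] ->
  \forall y \near x, y \notin `[c, d].
Proof.
rewrite in_itv/= negb_and -!ltNge => /orP[xc|dx].
  have : \forall y \near x, y < c by exact: open_lt.
  by apply: filterS => y yc; rewrite in_itv/= negb_and -!ltNge yc.
have : \forall y \near x, d < y by exact: open_gt.
by apply: filterS => y yc; rewrite in_itv/= negb_and -!ltNge yc orbT.
Qed.

(** Since phi vanishes near a and b, only the behaviour of P inside ]a, b[
    matters. *)
Lemma test_functionM (a b : R) P p phi :
  (forall x, x \in `]a, b[ -> is_derive x 1 P (p x)) ->
  (forall x, x \in `]a, b[ -> {for x, continuous p}) ->
  test_function a b phi ->
  test_function a b (P * phi) /\
  derive1 (P * phi) = fun x => p x * phi x + P x * derive1 phi x.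
Proof.
move=> dP cp [dphi cphi [c [d [ac db phi0]]]].
have nphi0 x : x \notin `[c, d] -> \forall y \near x, phi y = 0.
  by move=> /near_out_itv_cc; apply: filterS => y; exact: phi0.
have d1phi0 x : x \notin `[c, d] -> derive1 phi x = 0.
  by move=> /nphi0 nx; rewrite derive1E derive_near0.
have cdab x : x \in `[c, d] -> x \in `]a, b[.
  rewrite !in_itv/= => /andP[cx xd].
  by rewrite (lt_le_trans ac cx) (le_lt_trans xd db).
have dchi (x : R) : is_derive x 1 (P * phi) (p x * phi x + P x * derive1 phi x).
  have [/cdab xab|xcd] := boolP (x \in `[c, d]).
    have d1 := dP _ xab; have d2 : is_derive x 1 phi (derive1 phi x).
      by rewrite derive1E; apply: DeriveDef.
    apply: is_derive_eq; rewrite /GRing.scale/= addrC; congr (_ + _).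
    by rewrite mulrC.
  rewrite phi0// d1phi0// !mulr0 addr0.
  apply: (near_eq_is_derive (f := cst 0)).
  by apply: filterS (nphi0 _ xcd) => y phiy; rewrite mulrfctE /= phiy mulr0.
have d1chi : derive1 (P * phi) = fun x => p x * phi x + P x * derive1 phi x.
  by apply/funext => x; rewrite derive1E; have [] := dchi x.
split; last exact: d1chi.
split; first by move=> x; case: (dchi x) => dx _; exact: dx.
- rewrite d1chi => x; have [/cdab xab|xcd] := boolP (x \in `[c, d]).
    apply: cvgD; apply: cvgM.
    + exact: cp.
    + by apply: differentiable_continuous; apply/derivable1_diffP.
    + apply: differentiable_continuous; apply/derivable1_diffP.
      by have [] := dP _ xab.
    + exact: cphi.
  rewrite /continuous_at phi0// d1phi0// !mulr0 addr0.
  apply: cvg_near_cst; apply: filterS (near_out_itv_cc xcd) => y ycd.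
  by rewrite phi0// d1phi0// !mulr0 addr0.
- exists c, d; split => // x xcd.
  by rewrite mulrfctE phi0// mulr0.
Qed.

(** Weak derivatives obey the product rule with C^1 factors, so the
    fundamental theorem turns into integration by parts. *)
Lemma weak_IBP (a b c d : R) f g P p : a < b -> a <= c -> c < d -> d <= b ->
  {within `[a, b], continuous f} -> leb.-integrable `[a, b] (EFin \o g) ->
  weak_ibp a b f g ->
  (forall x, x \in `]a, b[ -> is_derive x 1 P (p x)) ->
  {within `[a, b], continuous P} -> {within `[a, b], continuous p} ->
  \int[leb]_(x in `[c, d]) (f x * p x) + \int[leb]_(x in `[c, d]) (g x * P x) =
  f d * P d - f c * P c.
Proof.
move=> ab ac cd db cf ig fg dP cP cp.
have cdab : `[c, d] `<=` `[a, b].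
  by apply: subset_itv; rewrite bnd_simp.
have ooab : `]a, b[ `<=` `[a, b] by exact: subset_itv_oo_cc.
have cpo x : x \in `]a, b[ -> {for x, continuous p}.
  by move=> xab; have /(continuous_within_itvP _ ab)[+ _ _] := cp; apply.
have iM (D : set R) u v : measurable D -> D `<=` `[a, b] ->
    leb.-integrable `[a, b] (EFin \o u) -> {within `[a, b], continuous v} ->
    leb.-integrable D (EFin \o (fun x => u x * v x)).
  move=> mD Dab iu cv.
  suff : leb.-integrable `[a, b] (EFin \o (fun x => u x * v x)).
    exact: integrableS.
  exact: integrable_mul_continuous.
have ic u : {within `[a, b], continuous u} -> leb.-integrable `[a, b] (EFin \o u).
  exact: within_continuous_integrable.
have icf := ic _ cf.
have ifp : leb.-integrable `[c, d] (EFin \o (fun x => f x * p x)) by exact: iM.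
have igP : leb.-integrable `[c, d] (EFin \o (fun x => g x * P x)) by exact: iM.
rewrite -RintegralD//.
rewrite -(@weak_FTC _ a b c d (fun x => f x * P x)) //.
- by move=> x; apply: cvgM; exact: continuous_subspaceW cdab _ _.
- have -> : EFin \o (fun x => f x * p x + g x * P x) =
     (EFin \o (fun x => f x * p x)) \+ (EFin \o (fun x => g x * P x)) by [].
  exact: integrableD.
move=> phi tphi.
have [tchi chiE] := test_functionM dP cpo tphi.
have cphi : {within `[a, b], continuous phi}.
  apply: derivable_within_continuous => x _; by case: tphi.
have cphi' : {within `[a, b], continuous (derive1 phi)}.
  by apply: continuous_subspaceT; case: tphi.
have cM := @within_continuousM `[a, b].
have iA : leb.-integrable `]a, b[
    (EFin \o (fun x => f x * (p x * phi x + P x * derive1 phi x))).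
  by apply: iM => //; apply: within_continuousD; exact: cM.
have iC : leb.-integrable `]a, b[ (EFin \o (fun x => f x * p x * phi x)).
  by apply: (iM _ (fun x => f x * p x)) => //; apply: ic; exact: cM.
have iB : leb.-integrable `]a, b[ (EFin \o (fun x => g x * (P x * phi x))).
  by apply: iM => //; exact: cM.
have := fg _ tchi; rewrite chiE => fgE.
transitivity (\int[leb]_(x in `]a, b[)
   (f x * (p x * phi x + P x * derive1 phi x) - f x * p x * phi x)).
  by apply: eq_Rintegral => x _; ring.
rewrite RintegralB// fgE -opprD -RintegralD//; congr (- _).
by apply: eq_Rintegral => x _; rewrite mulrfctE; ring.
Qed.

End WeakIBP.

(** * Uniqueness of weak derivatives *)

Section WeakUniqueness.
Context {R : realType}.
Notation leb := (@lebesgue_measure R).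
Implicit Types (f g h : R -> R).

Lemma ae_lebS (P Q : R -> Prop) : (forall x, P x -> Q x) ->
  {ae leb, forall x, P x} -> {ae leb, forall x, Q x}.
Proof.
by move=> PQ; apply: filterS; first exact: (ae_filter_ringOfSetsType leb).
Qed.

(** Lebesgue differentiation: the primitive of h from c vanishes on ]c, d[, and
    its derivative is h almost everywhere. *)
Lemma ae_eq0_itv (c d : R) h : c < d ->
  leb.-integrable `[c, d] (EFin \o h) ->
  (forall y, c < y < d -> \int[leb]_(x in `[c, y]) h x = 0) ->
  {ae leb, forall x, x \in `]c, d[ -> h x = 0}.
Proof.
move=> cd ih h0; pose k : R -> R := h \_ `[c, d].
have ik : leb.-integrable setT (EFin \o k).
  by rewrite /k -restrict_EFin; apply/integrable_restrict; rewrite ?setTI.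
have lk : locally_integrable setT k.
  exact: open_integrable_locally openT ik.
have iky y : leb.-integrable [set` Interval (BLeft c) (BRight y)] (EFin \o k).
  exact: integrableS ik.
have := FTC1 iky lk; apply: ae_lebS => x /= Hx; rewrite in_itv/= => /andP[cx xd].
have [|_ dF] := Hx; first by rewrite lte_fin.
have kx : k x = h x by rewrite /k patchE mem_set//= in_itv/= !ltW.
rewrite -kx -dF derive1E.
apply: derive_near0.
near=> y; have [cy yd] : c < y /\ y < d.
  have : y \in `]c, d[ by near: y; apply: near_in_itvoo; rewrite in_itv/= cx.
  by rewrite in_itv/= => /andP[].
transitivity (\int[leb]_(x in `[c, y]) h x); last by rewrite h0 ?cy.
apply: eq_Rintegral => z /set_mem/=.
rewrite in_itv/= => /andP[cz zy].
by rewrite /k patchE mem_set//= in_itv/= cz/= (le_trans zy) ?ltW.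
Unshelve. all: by end_near. Qed.

Lemma ae_eq0_oo (a b : R) h : a < b ->
  (forall c d, a < c -> c < d -> d < b ->
    leb.-integrable `[c, d] (EFin \o h) /\ \int[leb]_(x in `[c, d]) h x = 0) ->
  {ae leb, forall x, x \in `]a, b[ -> h x = 0}.
Proof.
move=> ab H.
pose e n : R := (b - a) / (2 * n.+2%:R).
have e0 n : 0 < e n by rewrite divr_gt0 ?subr_gt0// mulr_gt0.
have e2 n : 2 * e n < b - a.
  rewrite mulrC -mulrA gtr_pMr ?subr_gt0// invfM mulrAC mulVf// mul1r.
  by rewrite invf_lt1// ltr1n.
have : {ae leb, forall x : R, forall n, x \in `](a + e n), (b - e n)[ -> h x = 0}.
  apply/ae_foralln => n; have := e0 n; have := e2 n => e2n e0n.
  have cd : a + e n < b - e n by lra.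
  apply: ae_eq0_itv => //.
    by have [|//|//|] := H (a + e n) (b - e n) => //; lra.
  move=> y /andP[cy yd].
  by have [|//||] := H (a + e n) y => //; lra.
apply: ae_lebS => x Hx; rewrite in_itv/= => /andP[ax xb].
have ecvg : e n @[n --> \oo] --> 0.
  rewrite -(mulr0 ((b - a) / 2)).
  have -> : e = (fun n => (b - a) / 2 * harmonic n.+1).
    by apply/funext => n; rewrite /e /harmonic/= invfM mulrA.
  apply: cvgM; first exact: cvg_cst.
  by rewrite (cvg_shiftS (@harmonic R)); exact: cvg_harmonic.
have : \forall n \near \oo, e n < Num.min (x - a) (b - x).
  by apply: (cvgr_lt 0) => //; rewrite lt_min !subr_gt0 ax.
move=> [N _ /(_ N)]/=; rewrite leqnn => /(_ isT).
rewrite lt_min => /andP[? ?]; apply: (Hx N).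
by rewrite in_itv/=; apply/andP; split; lra.
Qed.

Lemma locally_integrable_itv (a b c d : R) g : a < c -> d < b ->
  locally_integrable `]a, b[ g -> leb.-integrable `[c, d] (EFin \o g).
Proof.
move=> ac db [mg _ ig].
have cdab : `[c, d] `<=` `]a, b[ by apply: subset_itv; rewrite bnd_simp.
apply/integrableP; split.
  by apply/measurable_EFinP; exact: measurable_funS mg.
exact: ig cdab (@segment_compact _ _ _).
Qed.

(** By weak_FTC the two candidates have the same integral f d - f c over every
    compact subinterval. *)
Lemma weak_derivative_unique (a b : R) f g1 g2 : a < b ->
  {within `[a, b], continuous f} ->
  weak_derivative a b f g1 -> weak_derivative a b f g2 ->
  {ae leb, forall x, x \in `]a, b[ -> g1 x = g2 x}.
Proof.
move=> ab cf [_ lg1 fg1] [_ lg2 fg2].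
have : {ae leb, forall x, x \in `]a, b[ -> (fun x => g1 x - g2 x) x = 0}.
  apply: ae_eq0_oo => // c d ac cd db.
  have i1 := locally_integrable_itv ac db lg1.
  have i2 := locally_integrable_itv ac db lg2.
  have ccd : {within `[c, d], continuous f}.
    by apply: continuous_subspaceW cf; apply: subset_itv; rewrite bnd_simp ltW.
  have aec := ltW ac; have dbe := ltW db.
  split.
    rewrite (_ : EFin \o _ = ((EFin \o g1) \- (EFin \o g2))%E)//.
    exact: integrableB.
  by rewrite RintegralB// -(weak_FTC aec cd dbe ccd i1 fg1)
    -(weak_FTC aec cd dbe ccd i2 fg2) subrr.
by apply: ae_lebS => x /[apply] /eqP; rewrite subr_eq0 => /eqP.
Qed.

(** Composition with the clamp extends a function on [c, d] by its boundary
    values, turning continuity on the interval into continuity on the line. *)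
Definition clamp (c d x : R) : R := Num.max c (Num.min d x).

Lemma clamp_itv c d x : c <= d -> c <= clamp c d x <= d.
Proof.
by move=> cd; rewrite /clamp le_max lexx/= ge_max cd ge_min lexx.
Qed.

Lemma clamp_id c d x : c <= x <= d -> clamp c d x = x.
Proof. by move=> /andP[cx xd]; rewrite /clamp min_r// max_r. Qed.

Lemma clamp_lip c d x y : `|clamp c d x - clamp c d y| <= `|x - y|.
Proof.
have maxl (u v : R) : `|Num.max c u - Num.max c v| <= `|u - v|.
  have := ler_norm (u - v); have := ler_norm (v - u); rewrite (distrC v u).
  by case: (leP c u) => ?; case: (leP c v) => ? ? ?; rewrite ler_norml;
    apply/andP; split; lra.
have minl (u v : R) : `|Num.min d u - Num.min d v| <= `|u - v|.
  have := ler_norm (u - v); have := ler_norm (v - u); rewrite (distrC v u).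
  by case: (leP d u) => ?; case: (leP d v) => ? ? ?; rewrite ler_norml;
    apply/andP; split; lra.
exact: le_trans (maxl _ _) (minl _ _).
Qed.

Lemma continuous_clamp c d f : c <= d -> {within `[c, d], continuous f} ->
  continuous (fun x => f (clamp c d x)).
Proof.
move=> cd cf x; apply/cvgrPdist_le => eta eta0.
have xcd : `[c, d]%classic (clamp c d x) by rewrite /= in_itv/= clamp_itv.
have [delta d0 H] := within_cont_dist cf xcd eta0.
near=> y; apply: H; first by rewrite /= in_itv/= clamp_itv.
apply: le_lt_trans (clamp_lip c d x y) _.
by near: y; exact: cvgr_dist_lt.
Unshelve. all: by end_near. Qed.

End WeakUniqueness.

(** * Weak derivatives of C^1 functions and of truncations *)

Section WeakExamples.
Context {R : realType}.
Notation leb := (@lebesgue_measure R).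
Implicit Types (f g h F : R -> R).

Lemma test_function_derive (a b : R) phi (x : R) : test_function a b phi ->
  is_derive x 1 phi (derive1 phi x).
Proof. by case=> dphi _ _; rewrite derive1E; apply: DeriveDef. Qed.

Lemma test_function_continuous (a b : R) phi : test_function a b phi ->
  continuous phi.
Proof.
by move=> [dphi _ _] x; apply: differentiable_continuous; apply/derivable1_diffP.
Qed.

Lemma test_function_bnd (a b : R) phi : test_function a b phi ->
  phi a = 0 /\ phi b = 0.
Proof.
move=> [_ _ [c [d [ac db phi0]]]]; split; apply: phi0.
  by rewrite in_itv/= negb_and -ltNge ac.
by rewrite in_itv/= negb_and -!ltNge db orbT.
Qed.

Lemma locally_integrable_oo (a b : R) f : leb.-integrable `[a, b] (EFin \o f) ->
  locally_integrable `]a, b[ f.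
Proof.
move=> intf; apply: open_integrable_locally; first exact: interval_open.
by apply: integrableS intf => //; exact: subset_itv_oo_cc.
Qed.

Lemma C1_weak_derivative (a b : R) F h : a < b ->
  {within `[a, b], continuous F} ->
  (forall x, x \in `]a, b[ -> is_derive x 1 F (h x)) ->
  {within `[a, b], continuous h} -> weak_derivative a b F h.
Proof.
move=> ab cF dF ch; have [_ Fa Fb] := (continuous_within_itvP _ ab).1 cF.
split; [exact/locally_integrable_oo/within_continuous_integrable..|].
move=> phi tphi; have [phia phib] := test_function_bnd tphi.
have cphi : {within `[a, b], continuous phi}.
  by apply: continuous_subspaceT; exact: test_function_continuous tphi.
have cphi' : {within `[a, b], continuous (derive1 phi)}.
  by apply: continuous_subspaceT; case: tphi.
have [_ phia' phib'] := (continuous_within_itvP _ ab).1 cphi.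
rewrite !Rintegral_itv_oo_cc; last 2 first.
- by apply: within_continuous_integrable; exact: within_continuousM.
- by apply: within_continuous_integrable; exact: within_continuousM.
rewrite (@Rintegration_by_parts _ F phi h) ?phia ?phib ?mulr0 ?subr0 ?sub0r//.
- by split=> // x /dF[].
- by move=> x /dF[? <-]; rewrite derive1E.
- by split=> // x _; have [] := test_function_derive x tphi.
Qed.

(** The condition under which cutting f off outside [c, d] creates no jump
    inside ]a, b[. *)
Definition vanishing_at_interior_ends (a b c d : R) f :=
  (c = a \/ f c = 0) /\ (d = b \/ f d = 0).

Lemma trunc_clamp (a b c d : R) f x : a <= c <= d -> d <= b ->
  vanishing_at_interior_ends a b c d f ->
  x \in `[a, b] -> (f \_ `[c, d]) x = f (clamp c d x).
Proof.
move=> /andP[ac cd] db [fc fd]; rewrite in_itv/= => /andP[ax xb].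
rewrite patchE; case: ifPn => [/set_mem/=|/negP xcd].
  by rewrite in_itv/= => xcd; rewrite clamp_id.
have : ~ (c <= x <= d) by move=> H; apply: xcd; rewrite mem_set//= in_itv.
move=> /negP; rewrite negb_and -!ltNge => /orP[xc|dx].
  have -> : clamp c d x = c.
    by rewrite /clamp min_r ?max_l ?ltW// (lt_le_trans xc).
  by case: fc => [ca|->//]; move: xc; rewrite ca ltNge ax.
have -> : clamp c d x = d.
  by rewrite /clamp min_l ?max_r // ltW.
by case: fd => [dd|->//]; move: dx; rewrite dd ltNge xb.
Qed.

Lemma trunc_continuous (a b c d : R) f : a <= c <= d -> d <= b ->
  vanishing_at_interior_ends a b c d f ->
  {within `[a, b], continuous f} -> {within `[a, b], continuous (f \_ `[c, d])}.
Proof.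
move=> acd db f0 cf; have /andP[ac cd] := acd.
have ccl : {within `[a, b], continuous (fun x => f (clamp c d x))}.
  apply: continuous_subspaceT; apply: continuous_clamp => //.
  by apply: continuous_subspaceW cf; apply: subset_itv; rewrite bnd_simp.
apply: subspace_eq_continuous ccl => x xab.
by apply/esym/(@trunc_clamp a b) => //; exact: set_mem xab.
Qed.

(** Integration by parts on [c, d]: the boundary terms vanish because at each
    end either f or the test function does. The weak derivative is cut to the
    open interval, so that the derivatives of two truncations to adjacent
    intervals have disjoint supports. *)
Lemma trunc_weak_derivative (a b c d : R) f g : a < b -> a <= c -> c < d -> d <= b ->
  vanishing_at_interior_ends a b c d f ->
  {within `[a, b], continuous f} -> leb.-integrable `[a, b] (EFin \o g) ->
  weak_ibp a b f g -> weak_derivative a b (f \_ `[c, d]) (g \_ `]c, d[).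
Proof.
move=> ab ac cd db [fc fd] cf ig fg.
have cdab : `[c, d] `<=` `[a, b] by apply: subset_itv; rewrite bnd_simp.
have icf := within_continuous_integrable cf.
have itr (D : set (measurableTypeR R)) u : measurable D ->
    leb.-integrable `[a, b] (EFin \o u) ->
    leb.-integrable `[a, b] (EFin \o (u \_ D)).
  move=> mD iu; rewrite -restrict_EFin; apply/integrable_restrict => //.
  by apply: integrableS iu => //; exact: measurableI.
split; [by apply: locally_integrable_oo; exact: itr..|].
move=> phi tphi; have [phia phib] := test_function_bnd tphi.
have cphi : {within `[a, b], continuous phi}.
  by apply: continuous_subspaceT; exact: test_function_continuous tphi.
have cphi' : {within `[a, b], continuous (derive1 phi)}.
  by apply: continuous_subspaceT; case: tphi.
have supp (D : set (measurableTypeR R)) u v : measurable D -> D `<=` `[a, b] ->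
    leb.-integrable `[a, b] (EFin \o u) -> {within `[a, b], continuous v} ->
    \int[leb]_(x in `]a, b[) ((u \_ D) x * v x) = \int[leb]_(x in D) (u x * v x).
  move=> mD Dab iu cv; rewrite Rintegral_itv_oo_cc; last first.
    exact: (integrable_mul_continuous (itr _ _ mD iu) cv).
  rewrite (@Rintegral_supp _ _ D).
  - by apply: eq_Rintegral => x xD; rewrite patchE xD.
  - by move=> x _ xD; rewrite patchE memNset ?mul0r.
  - by move=> x /Dab.
rewrite !supp//; last first.
  by apply: subset_trans cdab; exact: subset_itv_oo_cc.
rewrite Rintegral_itv_oo_cc; last first.
  by apply: integrableS (integrable_mul_continuous ig cphi).
have := weak_IBP ab ac cd db cf ig fg (fun x _ => test_function_derive x tphi) cphi cphi'.
have -> : f d * phi d = 0 by case: fd => ->; rewrite ?phib ?mulr0 ?mul0r.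
have -> : f c * phi c = 0 by case: fc => ->; rewrite ?phia ?mulr0 ?mul0r.
by move=> /eqP; rewrite subr0 addr_eq0 => /eqP.
Qed.

End WeakExamples.

(** * The measure mu and Lebesgue measure *)

Definition is_density {R : realType} (a b : R)
    (mu : probability (measurableTypeR R) R) (rho : R -> R) :=
  [/\ {within `[a, b], continuous rho},
      forall x, x \in `[a, b] -> 0 < rho x &
      forall A : set (measurableTypeR R), measurable A ->
        mu A = (\int[@lebesgue_measure R]_(x in A `&` `[a, b]) (rho x)%:E)%E].

Section Density.
Context {R : realType}.
Notation leb := (@lebesgue_measure R).
Variables (a b : R) (mu : probability (measurableTypeR R) R) (rho : R -> R).
Hypothesis ab : a < b.
Hypothesis hrho : is_density a b mu rho.

Let crho : {within `[a, b], continuous rho}. Proof. by case: hrho. Qed.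

Let rho_gt0 x : x \in `[a, b] -> 0 < rho x.
Proof. by case: hrho => _ + _; exact. Qed.

Let muE (A : set (measurableTypeR R)) : measurable A ->
  mu A = (\int[leb]_(x in A `&` `[a, b]) (rho x)%:E)%E.
Proof. by case: hrho => _ _; exact. Qed.

Implicit Types (f g h : R -> R).

Lemma density_lbound : exists2 m : R, 0 < m &
  forall x, x \in `[a, b] -> m <= rho x.
Proof.
have [c cab cmin] := EVT_min (ltW ab) crho.
by exists (rho c); first exact: rho_gt0.
Qed.

Lemma integrable_rho : leb.-integrable `[a, b] (EFin \o rho).
Proof. exact: within_continuous_integrable. Qed.

Lemma measurable_rho (D : set (measurableTypeR R)) : D `<=` `[a, b] ->
  measurable_fun D (EFin \o rho).
Proof.
by move=> Dab; apply: (measurable_funS _ Dab) => //; case/integrableP: integrable_rho.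
Qed.

Lemma mu_dominated : mu `<< leb.
Proof.
apply/null_content_dominatesP => A mA A0; rewrite muE//.
apply: null_set_integral => //; first exact: measurableI.
  by apply: measurable_rho; exact: subIsetr.
apply/eqP; rewrite eq_le measure_ge0 andbT -A0.
by apply: le_measure; rewrite ?inE//; exact: measurableI.
Qed.

Let RN := Radon_Nikodym_SigmaFinite.f mu leb.

(** Both functions integrate to mu A over every measurable subset A of D. *)
Lemma RN_density (D : set (measurableTypeR R)) : measurable D -> D `<=` `[a, b] ->
  ae_eq leb D RN (EFin \o rho).
Proof.
move=> mD Dab; apply: integral_ae_eq => //.
- apply: integrableS (Radon_Nikodym_SigmaFinite.f_integrable mu_dominated) => //.
- exact: measurable_rho.
- move=> A AD mA.
  transitivity (mu A).
    exact/esym/(Radon_Nikodym_SigmaFinite.f_integral mu_dominated).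
  by rewrite muE// setIidl//; exact: subset_trans AD Dab.
Qed.

Lemma ge0_integral_density (D : set (measurableTypeR R)) (f : R -> \bar R) :
  measurable D -> D `<=` `[a, b] -> measurable_fun D f -> (forall x, 0 <= f x)%E ->
  (\int[mu]_(x in D) f x = \int[leb]_(x in D) (f x * (rho x)%:E))%E.
Proof.
move=> mD Dab mf f0.
rewrite -(Radon_Nikodym_SigmaFinite.change_of_variables mu_dominated f0 mD mf).
have mrho := measurable_rho Dab.
apply: ae_eq_integral => //.
- apply: emeasurable_funM => //.
  apply: measurable_funTS.
  by case/integrableP: (Radon_Nikodym_SigmaFinite.f_integrable mu_dominated).
- exact: emeasurable_funM.
- by apply: ae_eqe_mul2l; exact: RN_density.
Qed.

(** The density is bounded below by a positive constant on [a, b]. *)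
Lemma integrable_density (D : set (measurableTypeR R)) f :
  measurable D -> D `<=` `[a, b] -> mu.-integrable D (EFin \o f) ->
  leb.-integrable D (EFin \o f).
Proof.
move=> mD Dab /integrableP[mf intf]; apply/integrableP; split=> //.
have [m m0 mrho_le] := density_lbound.
have mnf : measurable_fun D (fun x => `|(EFin \o f) x|%E) by exact: measurableT_comp.
have mrho := measurable_rho Dab.
rewrite ge0_integral_density// in intf.
have le1 : (m%:E * \int[leb]_(x in D) `|(EFin \o f) x| <=
    \int[leb]_(x in D) (`|(EFin \o f) x| * (rho x)%:E))%E.
  rewrite -ge0_integralZl//; last by rewrite lee_fin ltW.
  apply: ge0_le_integral => //.
  - by move=> x _; rewrite mule_ge0// lee_fin ltW.
  - exact: measurable_funeM.
  - exact: emeasurable_funM.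
  - move=> x Dx; rewrite muleC lee_wpmul2l// lee_fin.
    exact: mrho_le (Dab _ Dx).
have := le_lt_trans le1 intf; rewrite -lte_pdivlMl//.
by move=> /lt_le_trans; apply; rewrite leey.
Qed.

Lemma Rintegral_density (D : set (measurableTypeR R)) f :
  measurable D -> D `<=` `[a, b] -> mu.-integrable D (EFin \o f) ->
  \int[mu]_(x in D) f x = \int[leb]_(x in D) (f x * rho x).
Proof.
move=> mD Dab intf; rewrite /Rintegral; congr fine.
have mf : measurable_fun D (EFin \o f) by case/integrableP: intf.
have mrho := measurable_rho Dab.
rewrite -(Radon_Nikodym_change_of_variables mu_dominated mD intf).
apply: ae_eq_integral => //.
- apply: emeasurable_funM => //; apply: measurable_funTS.
  by case/integrableP: (@Radon_Nikodym_integrable _ _ _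
    (charge_of_finite_measure mu) leb mu_dominated).
- exact: (emeasurable_funM mf mrho).
- rewrite (_ : (fun x => (f x * rho x)%:E) = (EFin \o f) \* (EFin \o rho))%E//.
  apply: ae_eqe_mul2l.
  apply: ae_eq_trans (RN_density mD Dab); apply: ae_eq_sym.
  by apply: ae_eq_Radon_Nikodym_SigmaFinite => //; exact: mu_dominated.
Qed.

Lemma ae_mu (P : R -> Prop) : {ae leb, forall x, x \in `]a, b[ -> P x} ->
  {ae mu, forall x, x \in `[a, b] -> P x}.
Proof.
move=> Pab.
have : {ae leb, forall x, x \in `[a, b] -> P x}.
  have na : {ae leb, forall x, x <> a}.
    exists [set a]; split => //; first by rewrite lebesgue_measure_set1.
    by move=> x /= /contrapT.
  have nb : {ae leb, forall x, x <> b}.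
    exists [set b]; split => //; first by rewrite lebesgue_measure_set1.
    by move=> x /= /contrapT.
  apply: filterS3 Pab na nb; first exact: (ae_filter_ringOfSetsType leb).
  move=> x Px xa xb; rewrite in_itv/= !le_eqVlt => /andP[/predU1P[/esym//|ax] /predU1P[//|xb']].
  by apply: Px; rewrite in_itv/= ax.
move=> [N [mN N0 sub]]; exists N; split => //.
by move/null_content_dominatesP : mu_dominated; apply.
Qed.

End Density.

(** * Square-integrable functions *)

Section L2.
Context {R : realType}.
Notation leb := (@lebesgue_measure R).
Variables (a b : R) (mu : probability (measurableTypeR R) R) (rho : R -> R).
Hypothesis ab : a < b.
Hypothesis hrho : is_density a b mu rho.
Implicit Types (f g h : R -> R).
Let I : set (measurableTypeR R) := `[a, b]%classic.
Let mI : measurable I. Proof. exact: measurable_itv. Qed.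

Notation L2 := (L2 a b mu).
Notation L2_inner := (L2_inner a b mu).

Lemma L2P f :
  L2 f <-> measurable_fun I f /\ mu.-integrable I (EFin \o (fun x => f x ^+ 2)).
Proof.
have sqE : (fun x => (f \_ I) x ^+ 2) = (fun x => f x ^+ 2) \_ I.
  apply/funext => x; rewrite !patchE; case: ifPn => // _.
  by rewrite expr0n.
split=> [l2f|[mf intf]].
  have [mf _] := andP l2f; move: mf; rewrite inE/= => mf.
  split; first exact/(measurable_restrictT _ mI).
  have := Lfun2_integrable_sqr l2f; rewrite sqE -restrict_EFin.
  by move/(integrable_restrict _ mI measurableT); rewrite setTI.
have mfI : measurable_fun setT (f \_ I) by exact/(measurable_restrictT _ mI).
apply/andP; split; first by rewrite inE.
rewrite inE/= /finite_norm unlock /Lnorm poweR_lty//.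
have intT : mu.-integrable setT (EFin \o (fun x => (f \_ I) x ^+ 2)).
  rewrite sqE -restrict_EFin; apply/(integrable_restrict _ mI measurableT).
  by rewrite setTI.
have /integrableP[_] := intT; apply: le_lt_trans.
rewrite le_eqVlt; apply/orP; left; apply/eqP.
apply: eq_integral => x _ /=.
by rewrite powR_mulrn// -normrX.
Qed.

Lemma L2_measurable f : L2 f -> measurable_fun I f.
Proof. by case/L2P. Qed.

Lemma L2_sqr f : L2 f -> mu.-integrable I (EFin \o (fun x => f x ^+ 2)).
Proof. by case/L2P. Qed.

Lemma L2_mul f g : L2 f -> L2 g -> mu.-integrable I (EFin \o (fun x => f x * g x)).
Proof.
move=> lf lg.
have i2 := integrableD mI (L2_sqr lf) (L2_sqr lg).
apply: le_integrable i2 => //.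
  apply/measurable_EFinP; apply: measurable_funM; exact: L2_measurable.
move=> x _ /=; rewrite lee_fin [leRHS]ger0_norm ?addr_ge0 ?sqr_ge0//.
rewrite normrM -[f x ^+ 2]real_normK ?num_real// -[g x ^+ 2]real_normK ?num_real//.
have := sqr_ge0 (`|f x| - `|g x|); have := normr_ge0 (f x).
have := normr_ge0 (g x); nra.
Qed.

Lemma integrable_lin (k : R) f g :
  mu.-integrable I (EFin \o f) -> mu.-integrable I (EFin \o g) ->
  mu.-integrable I (EFin \o (k *: f + g)).
Proof.
move=> intf intg.
exact: (integrableD mI (integrableZl mI k intf) intg).
Qed.

Lemma L2_lin (k : R) f g : L2 f -> L2 g -> L2 (k *: f + g).
Proof.
move=> lf lg; apply/L2P; split.
  apply: measurable_funD; last exact: L2_measurable.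
  by apply: measurable_funM => //; exact: L2_measurable.
have -> : (fun x => (k *: f + g) x ^+ 2) =
  (k ^+ 2) *: (fun x => f x ^+ 2) + ((2 * k) *: (fun x => f x * g x) +
    (fun x => g x ^+ 2)).
  by apply/funext => x; rewrite !fctE /GRing.scale/=; ring.
apply: integrable_lin; first exact: L2_sqr.
by apply: integrable_lin; [exact: L2_mul|exact: L2_sqr].
Qed.

Lemma mu_integrable_continuous f : {within I, continuous f} ->
  mu.-integrable I (EFin \o f).
Proof.
move=> cf; apply: measurable_bounded_integrable => //.
- by rewrite ltey_eq fin_num_measure.
- exact: subspace_continuous_measurable_fun.
- have /compact_bounded[M [_ Mv]] : compact (f @` I).
    by apply: continuous_compact => //; exact: segment_compact.
  by exists M; split; rewrite ?num_real // => ? ? ? ?; exact: Mv.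
Qed.

Lemma L2_continuous f : {within I, continuous f} -> L2 f.
Proof.
move=> cf; apply/L2P; split; first exact: subspace_continuous_measurable_fun.
apply: mu_integrable_continuous.
by rewrite (_ : (fun x => _) = (fun x => f x * f x))//; exact: within_continuousM.
Qed.

Lemma L2_integrable f : L2 f -> mu.-integrable I (EFin \o f).
Proof.
move=> lf; have l1 : L2 (cst 1) by apply: L2_continuous => x; exact: cvg_cst.
have := L2_mul lf l1; rewrite (_ : (fun x => _ * _) = f)//.
by apply/funext => x; rewrite mulr1.
Qed.

Lemma L2_leb_integrable f : L2 f -> leb.-integrable I (EFin \o f).
Proof. by move=> /L2_integrable; exact: (integrable_density ab hrho mI). Qed.

Lemma L2_ae f g : L2 f -> measurable_fun I g ->
  {ae mu, forall x, x \in `[a, b] -> f x = g x} -> L2 g.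
Proof.
move=> lf mg fg; apply/L2P; split => //.
have /integrableP[mf2 intf] := L2_sqr lf.
have mg2 : measurable_fun I (EFin \o (fun x => g x ^+ 2)).
  by apply/measurable_EFinP; exact: measurable_funX.
apply/integrableP; split => //.
rewrite (le_lt_trans _ intf)// le_eqVlt; apply/orP; left; apply/eqP.
apply: ae_eq_integral => //.
- exact: measurableT_comp.
- exact: measurableT_comp.
- apply: filterS fg; first exact: (ae_filter_ringOfSetsType mu).
  by move=> x /= H Ix; rewrite H.
Qed.

Lemma L2_trunc f (D : set (measurableTypeR R)) : measurable D -> L2 f ->
  L2 (f \_ D).
Proof.
move=> mD lf; have mf : measurable_fun I (f \_ D).
  apply/measurable_restrict => //; apply: measurable_funS (L2_measurable lf) => //.
apply/L2P; split => //; apply: le_integrable (L2_sqr lf) => //.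
  by apply/measurable_EFinP; exact: measurable_funX.
move=> x _ /=; rewrite lee_fin patchE; case: ifPn => // _.
by rewrite expr0n/= normr0.
Qed.

Lemma L2_innerC f g : L2_inner f g = L2_inner g f.
Proof. by apply: eq_Rintegral => x _; rewrite mulrC. Qed.

Lemma L2_inner_linl (k : R) f g h : L2 f -> L2 g -> L2 h ->
  L2_inner (k *: f + g) h = k * L2_inner f h + L2_inner g h.
Proof.
move=> lf lg lh; have ifh := L2_mul lf lh; have igh := L2_mul lg lh.
rewrite /Defs.L2_inner -RintegralZl// -RintegralD//.
  by apply: eq_Rintegral => x _; rewrite !fctE /GRing.scale/= mulrDl mulrA.
exact: (integrableZl mI k ifh).
Qed.

Lemma L2_inner_ge0 f : 0 <= L2_inner f f.
Proof. by apply: Rintegral_ge0 => x _; rewrite -expr2 sqr_ge0. Qed.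

Lemma L2_inner_ae f f' g g' : L2 f -> L2 f' -> L2 g -> L2 g' ->
  {ae mu, forall x, x \in `[a, b] -> f x = f' x} ->
  {ae mu, forall x, x \in `[a, b] -> g x = g' x} ->
  L2_inner f g = L2_inner f' g'.
Proof.
move=> lf lf' lg lg' ff' gg'; rewrite /Defs.L2_inner /Rintegral; congr fine.
have := L2_mul lf lg => /integrableP[m1 _].
have := L2_mul lf' lg' => /integrableP[m2 _].
apply: ae_eq_integral => //.
apply: filterS2 ff' gg'; first exact: (ae_filter_ringOfSetsType mu).
by move=> x /= H1 H2 Ix; rewrite H1// H2.
Qed.

End L2.

(** * The space H^1 and its Dirichlet form *)

Section H1Space.
Context {R : realType}.
Notation leb := (@lebesgue_measure R).
Variables (a b : R) (mu : probability (measurableTypeR R) R) (rho : R -> R).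
Hypothesis ab : a < b.
Hypothesis hrho : is_density a b mu rho.
Implicit Types (f g h : R -> R).
Let I : set (measurableTypeR R) := `[a, b]%classic.
Let mI : measurable I. Proof. exact: measurable_itv. Qed.

Notation L2 := (L2 a b mu).
Notation L2_inner := (L2_inner a b mu).
Notation in_H1 := (in_H1 a b mu).
Notation wderiv := (wderiv a b).

Lemma in_H1_intro f g : {within I, continuous f} -> weak_derivative a b f g ->
  L2 g -> in_H1 f.
Proof. by move=> cf fg lg; split=> //; [exact: L2_continuous|exists g]. Qed.

Lemma in_H1_continuous f : in_H1 f -> {within I, continuous f}.
Proof. by case. Qed.

Lemma in_H1_L2 f : in_H1 f -> L2 f.
Proof. by case. Qed.

Lemma wderivP f : in_H1 f -> weak_derivative a b f (wderiv f).
Proof. by move=> [_ _ [g [fg _]]]; exact: (xgetPex _ (ex_intro _ g fg)). Qed.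

Lemma weak_derivative_ae f g1 g2 : in_H1 f ->
  weak_derivative a b f g1 -> weak_derivative a b f g2 ->
  {ae mu, forall x, x \in `[a, b] -> g1 x = g2 x}.
Proof.
move=> fH1 fg1 fg2.
have := weak_derivative_unique ab (in_H1_continuous fH1) fg1 fg2.
exact: (ae_mu hrho).
Qed.

Lemma weak_derivative_measurable f g : weak_derivative a b f g ->
  measurable_fun I g.
Proof.
move=> [_ [mg _ _] _].
have mco : measurable_fun `[a, b[ g by exact/measurable_fun_itv_obnd_cbndP.
exact/measurable_fun_itv_bndo_bndcP.
Qed.

Lemma weak_derivative_L2 f g : in_H1 f -> weak_derivative a b f g -> L2 g.
Proof.
move=> fH1 fg; have [_ _ [g' [fg' lg']]] := fH1.
apply: (L2_ae lg'); first exact: weak_derivative_measurable fg.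
exact: weak_derivative_ae fg' fg.
Qed.

Lemma wderiv_L2 f : in_H1 f -> L2 (wderiv f).
Proof. by move=> fH1; exact: weak_derivative_L2 (wderivP fH1). Qed.

Lemma wderiv_integrable f : in_H1 f -> leb.-integrable I (EFin \o wderiv f).
Proof. by move=> fH1; apply: (L2_leb_integrable ab hrho); exact: wderiv_L2. Qed.

Lemma wderiv_weak_ibp f : in_H1 f -> weak_ibp a b f (wderiv f).
Proof. by move=> /wderivP[]. Qed.

Definition dirichlet f g := L2_inner (wderiv f) (wderiv g).

(** The Dirichlet form may be computed with any weak derivatives, since they
    agree almost everywhere with the chosen ones. *)
Lemma dirichletE f f' g g' : in_H1 f -> in_H1 g ->
  weak_derivative a b f f' -> weak_derivative a b g g' ->
  dirichlet f g = L2_inner f' g'.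
Proof.
move=> fH1 gH1 ff' gg'; apply: L2_inner_ae.
- exact: wderiv_L2.
- exact: weak_derivative_L2 ff'.
- exact: wderiv_L2.
- exact: weak_derivative_L2 gg'.
- by apply: weak_derivative_ae ff' => //; exact: wderivP.
- by apply: weak_derivative_ae gg' => //; exact: wderivP.
Qed.

Lemma weak_derivative_lin (k : R) f f' g g' :
  {within I, continuous f} -> {within I, continuous g} ->
  leb.-integrable I (EFin \o f') -> leb.-integrable I (EFin \o g') ->
  weak_derivative a b f f' -> weak_derivative a b g g' ->
  weak_derivative a b (k *: f + g) (k *: f' + g').
Proof.
move=> cf cg if' ig' [_ _ ff'] [_ _ gg'].
have ilin u v : leb.-integrable I (EFin \o u) -> leb.-integrable I (EFin \o v) ->
    leb.-integrable I (EFin \o (k *: u + v)).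
  by move=> iu iv; exact: (integrableD mI (integrableZl mI k iu) iv).
have icf := within_continuous_integrable cf.
have icg := within_continuous_integrable cg.
split; [exact/locally_integrable_oo/ilin..|move=> phi tphi].
have cphi : {within `[a, b], continuous phi}.
  by apply: continuous_subspaceT; exact: test_function_continuous tphi.
have cphi' : {within `[a, b], continuous (derive1 phi)}.
  by apply: continuous_subspaceT; case: tphi.
have dist u v w : leb.-integrable I (EFin \o u) -> leb.-integrable I (EFin \o v) ->
    {within I, continuous w} ->
    \int[leb]_(x in `]a, b[) ((k *: u + v) x * w x) =
    k * \int[leb]_(x in `]a, b[) (u x * w x) + \int[leb]_(x in `]a, b[) (v x * w x).
  move=> iu iv cw.
  have iuw := integrable_mul_continuous iu cw.
  have ivw := integrable_mul_continuous iv cw.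
  have iuvw := integrable_mul_continuous (ilin _ _ iu iv) cw.
  rewrite !Rintegral_itv_oo_cc// -RintegralZl// -RintegralD//.
    by apply: eq_Rintegral => x _; rewrite !fctE /GRing.scale/= mulrDl mulrA.
  exact: (integrableZl mI k iuw).
by rewrite !dist// ff'// gg'// mulrN -opprD.
Qed.

Lemma in_H1_lin (k : R) f g : in_H1 f -> in_H1 g -> in_H1 (k *: f + g).
Proof.
move=> fH1 gH1; have cf := in_H1_continuous fH1; have cg := in_H1_continuous gH1.
apply: (@in_H1_intro _ (k *: wderiv f + wderiv g)).
- by move=> x; apply: cvgD; [apply: cvgZr; exact: cf|exact: cg].
- by apply: weak_derivative_lin => //; [exact: wderiv_integrable..|exact: wderivP|exact: wderivP].
- by apply: L2_lin; exact: wderiv_L2.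
Qed.

Lemma in_H1_0 : in_H1 0.
Proof.
have c0 : {within I, continuous (0 : R -> R)} by move=> x; exact: cvg_cst.
apply: (@in_H1_intro _ 0) => //; last exact: L2_continuous.
by apply: C1_weak_derivative => // x _; exact: is_derive_cst.
Qed.

Lemma dirichlet_linl (k : R) f g h : in_H1 f -> in_H1 g -> in_H1 h ->
  dirichlet (k *: f + g) h = k * dirichlet f h + dirichlet g h.
Proof.
move=> fH1 gH1 hH1; have cf := in_H1_continuous fH1; have cg := in_H1_continuous gH1.
rewrite (@dirichletE _ (k *: wderiv f + wderiv g) _ (wderiv h))//.
- by rewrite L2_inner_linl//; exact: wderiv_L2.
- exact: in_H1_lin.
- by apply: weak_derivative_lin => //; [exact: wderiv_integrable..|exact: wderivP|exact: wderivP].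
- exact: wderivP.
Qed.

Lemma L2_prehilbert : is_prehilbert (InnerSpace in_H1 L2_inner).
Proof.
split=> /=; [exact: in_H1_0|exact: in_H1_lin| | |].
- by move=> k f g h fH1 gH1 hH1; apply: L2_inner_linl; exact: in_H1_L2.
- by move=> f g _ _; exact: L2_innerC.
- by move=> f _; exact: L2_inner_ge0.
Qed.

Lemma dirichlet_prehilbert : is_prehilbert (InnerSpace in_H1 dirichlet).
Proof.
split=> /=; [exact: in_H1_0|exact: in_H1_lin|exact: dirichlet_linl| |].
- by move=> f g _ _; exact: L2_innerC.
- by move=> f _; exact: L2_inner_ge0.
Qed.

Lemma H1_prehilbert : is_prehilbert (H1 a b mu).
Proof.
have [_ _ lA sA pA] := L2_prehilbert.
have [_ _ lB sB pB] := dirichlet_prehilbert.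
have H1E f g : inner (H1 a b mu) f g =
    inner (InnerSpace in_H1 L2_inner) f g + inner (InnerSpace in_H1 dirichlet) f g.
  by [].
split; [exact: in_H1_0|exact: in_H1_lin| | |].
- move=> k f g h fH1 gH1 hH1; rewrite !H1E (lA k f g h fH1 gH1 hH1).
  by rewrite (lB k f g h fH1 gH1 hH1) mulrDr addrACA.
- by move=> f g fH1 gH1; rewrite !H1E (sA f g fH1 gH1) (sB f g fH1 gH1).
- by move=> f fH1; rewrite H1E; exact: addr_ge0 (pA f fH1) (pB f fH1).
Qed.

(** As rho is positive, zero energy makes the weak derivative vanish almost
    everywhere, and f is the integral of its weak derivative. *)
Lemma dirichlet_eq0 f : in_H1 f -> dirichlet f f = 0 ->
  forall x y, x \in `[a, b] -> y \in `[a, b] -> f x = f y.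
Proof.
move=> fH1 f0.
have cf := in_H1_continuous fH1.
have lw := wderiv_L2 fH1.
pose E x := wderiv f x * wderiv f x * rho x.
have iw2 : mu.-integrable I (EFin \o (fun x => wderiv f x * wderiv f x)).
  exact: L2_mul.
have mw : measurable_fun I (wderiv f) := L2_measurable lw.
have mE : measurable_fun I (EFin \o E).
  apply/measurable_EFinP; apply: measurable_funM; first exact: measurable_funM.
  by apply: subspace_continuous_measurable_fun => //; case: hrho.
have E0 x : x \in `[a, b] -> 0 <= E x.
  move=> xab; rewrite mulr_ge0 -?expr2 ?sqr_ge0// ltW//.
  by case: hrho => _ + _; exact.
have intE : (\int[leb]_(x in I) `|(EFin \o E) x| = 0)%E.
  have : (\int[mu]_(x in I) (wderiv f x * wderiv f x)%:E = 0)%E.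
    rewrite -[LHS]fineK ?(integrable_fin_num mI iw2)//.
    by congr EFin.
  rewrite (ge0_integral_density hrho)//; last 2 first.
  - by case/integrableP: iw2.
  - by move=> x; rewrite lee_fin -expr2 sqr_ge0.
  move=> E00; rewrite -[RHS]E00; apply: eq_integral => x /set_mem xI.
  by rewrite gee0_abs// lee_fin E0.
have wae : {ae leb, forall x, I x -> wderiv f x = 0}.
  move/(ae_eq_integral_abs leb mI mE).1 : intE.
  apply: ae_lebS => x /= + xI => /(_ xI)[] /eqP.
  rewrite mulf_eq0 mulf_eq0 orbb => /orP[/eqP//|/eqP r0].
  by have : 0 < rho x by [case: hrho => _ + _; exact]; rewrite r0 ltxx.
have fxy x y : x \in `[a, b] -> y \in `[a, b] -> x < y -> f x = f y.
  rewrite !in_itv/= => /andP[ax xb] /andP[ay yb] xy.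
  have xyI : `[x, y] `<=` I by apply: subset_itv; rewrite bnd_simp.
  have ixy : leb.-integrable `[x, y] (EFin \o wderiv f).
    by apply: integrableS (wderiv_integrable fH1).
  have := weak_FTC ax xy yb (continuous_subspaceW xyI cf) ixy (wderiv_weak_ibp fH1).
  have -> : \int[leb]_(z in `[x, y]) wderiv f z = 0.
    rewrite /Rintegral.
    have -> : (\int[leb]_(z in `[x, y]) (wderiv f z)%:E = \int[leb]_(z in `[x, y]) cst 0 z)%E.
      apply: ae_eq_integral => //; first by case/integrableP: ixy.
      by move: wae; apply: ae_lebS => z /= H /xyI zI; rewrite H.
    by rewrite integral0.
  by move/eqP; rewrite subr_eq0 => /eqP.
move=> x y xI yI; have [xy|yx|->//] := ltgtP x y; first exact: fxy.
exact/esym/fxy.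
Qed.

End H1Space.

(** * Regularity of the eigenfunctions *)

Section Regularity.
Context {R : realType}.
Notation leb := (@lebesgue_measure R).
Variables (a b : R) (mu : probability (measurableTypeR R) R) (rho : R -> R).
Hypothesis ab : a < b.
Hypothesis hrho : is_density a b mu rho.
Implicit Types (f g h : R -> R).
Let I : set (measurableTypeR R) := `[a, b]%classic.

Notation L2_inner := (L2_inner a b mu).
Notation in_H1 := (in_H1 a b mu).
Notation wderiv := (wderiv a b).
Notation dirichlet := (dirichlet a b mu).

Let crho : {within `[a, b], continuous rho}. Proof. by case: hrho. Qed.

Let rho_gt0 x : x \in `[a, b] -> 0 < rho x.
Proof. by case: hrho => _ + _; exact. Qed.

Lemma primitive_C1 h : {within `[a, b], continuous h} ->
  exists H : R -> R,
  [/\ H a = 0, H b = \int[leb]_(x in `[a, b]) h x,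
      {within `[a, b], continuous H} &
      forall x, x \in `]a, b[ -> is_derive x 1 H (h x)].
Proof.
move=> ch; have ih := within_continuous_integrable ch.
pose H x := \int[leb]_(t in `[a, x]) h t; exists H; split => //.
- by rewrite /H set_itv1 Rintegral_set1.
- exact: parameterized_integral_continuous (ltW ab) ih.
- move=> x xab; have [cx _ _] := (continuous_within_itvP _ ab).1 ch.
  have /andP[ax xb] : a < x < b by move: xab; rewrite in_itv.
  have [dH HE] := continuous_FTC1_closed xb ih ax (cx _ xab).
  by apply: DeriveDef; [exact: dH|rewrite -derive1E].
Qed.

Lemma within_continuous_inv_rho : {within `[a, b], continuous (fun x => (rho x)^-1)}.
Proof.
have crc : {within `[a, b], continuous (fun x => (rho (clamp a b x))^-1)}.
  apply: continuous_subspaceT => x; apply: cvgV.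
    by rewrite gt_eqF// rho_gt0// in_itv/= clamp_itv// ltW.
  exact: continuous_clamp (ltW ab) crho x.
apply: subspace_eq_continuous crc => x /set_mem; rewrite /= in_itv/= => xab.
by rewrite /from_subspace/= clamp_id.
Qed.

Lemma in_H1_C1 f h : {within `[a, b], continuous f} ->
  (forall x, x \in `]a, b[ -> is_derive x 1 f (h x)) ->
  {within `[a, b], continuous h} -> in_H1 f.
Proof.
move=> cf df ch; apply: in_H1_intro (C1_weak_derivative ab cf df ch) _ => //.
exact: L2_continuous.
Qed.

Lemma within_continuous_cst (k : R) : {within `[a, b], continuous (fun=> k)}.
Proof. by move=> x; exact: cvg_cst. Qed.

Lemma in_H1_cst (k : R) : in_H1 (fun=> k).
Proof.
by apply: (@in_H1_C1 _ (fun=> 0)); exact: within_continuous_cst.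
Qed.

Lemma dirichlet_cst f (k : R) : in_H1 f -> dirichlet f (fun=> k) = 0.
Proof.
move=> fH1.
rewrite (dirichletE ab hrho fH1 (in_H1_cst k) (wderivP fH1) (g' := fun=> 0)).
  rewrite /Defs.L2_inner; under eq_Rintegral do rewrite mulr0.
  by rewrite Rintegral_cst// mul0r.
by apply: C1_weak_derivative => //; exact: within_continuous_cst.
Qed.

(** Let P be the integral of l rho f from a; testing the eigenvalue equation
    with 1 gives P b = 0, and integration by parts shows that the primitive
    psi of - P / rho solves the same weak equation as f. Hence f - psi has zero
    Dirichlet energy, and f inherits the regularity of psi. *)
Lemma eigen_regular f (l : R) : poincare_eigenpair a b mu f l ->
  exists P : R -> R,
    [/\ P a = 0, P b = 0, {within `[a, b], continuous P},
        forall x, x \in `]a, b[ -> is_derive x 1 P (l * rho x * f x) &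
        forall x, x \in `]a, b[ -> is_derive x 1 f (- P x / rho x)].
Proof.
move=> [fH1 eig]; have cf := in_H1_continuous fH1.
pose p x := l * rho x * f x.
have cp : {within `[a, b], continuous p}.
  apply: within_continuousM => //; apply: within_continuousM => //.
  exact: within_continuous_cst.
have [P [Pa Pbp cP dP]] := primitive_C1 cp.
have Pb : P b = 0.
  have := eig _ (in_H1_cst 1); rewrite -/(dirichlet _ _) dirichlet_cst// => fl.
  rewrite Pbp [RHS]fl /Defs.L2_inner (Rintegral_density hrho)//; last first.
    by apply: mu_integrable_continuous; apply: within_continuousM => //; exact: within_continuous_cst.
  rewrite -RintegralZl//; first by apply: eq_Rintegral => x _; rewrite /p; ring.
  apply: within_continuous_integrable; apply: within_continuousM => //.
  by apply: within_continuousM => //; exact: within_continuous_cst.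
pose q x := - P x / rho x.
have cq : {within `[a, b], continuous q}.
  apply: within_continuousM; last exact: within_continuous_inv_rho.
  by move=> x; apply: cvgN; exact: cP.
have [psi [psia _ cpsi dpsi]] := primitive_C1 cq.
have psiH1 : in_H1 psi by exact: in_H1_C1 cpsi dpsi cq.
have wpsi := C1_weak_derivative ab cpsi dpsi cq.
have eig_psi g : in_H1 g -> dirichlet psi g = l * L2_inner f g.
  move=> gH1; have cg := in_H1_continuous gH1; have ig := wderiv_integrable ab hrho gH1.
  rewrite (dirichletE ab hrho psiH1 gH1 wpsi (wderivP gH1)).
  have := weak_IBP ab (lexx a) ab (lexx b) cg ig (wderiv_weak_ibp gH1) dP cP cp.
  rewrite Pa Pb !mulr0 subr0 => /eqP; rewrite addr_eq0 => /eqP IBP.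
  rewrite /Defs.L2_inner !(Rintegral_density hrho)//; last 2 first.
  - by apply: mu_integrable_continuous; exact: within_continuousM.
  - by apply: L2_mul; [exact: L2_continuous|exact: (wderiv_L2 ab hrho)].
  rewrite -RintegralZl//; last first.
    by apply: within_continuous_integrable; do 2! apply: within_continuousM => //.
  transitivity (\int[leb]_(x in `[a, b]) (g x * p x)); last first.
    by apply: eq_Rintegral => x _; rewrite /p; ring.
  rewrite IBP -mulN1r -RintegralZl//; last first.
    exact: (integrable_mul_continuous ig cP).
  apply: eq_Rintegral => x /set_mem/= xab; rewrite /q.
  by field; rewrite gt_eqF// rho_gt0.
have hS := dirichlet_prehilbert ab hrho.
have DH1 : in_H1 (f - psi) by exact: (carrierB hS fH1 psiH1).
have D0 : dirichlet (f - psi) (f - psi) = 0.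
  have := innerBl hS fH1 psiH1 DH1 => /= ->.
  by rewrite eig_psi// [dirichlet _ _]eig// subrr.
have fE x : x \in `[a, b] -> f x = f a + psi x.
  move=> xab; have aab : a \in `[a, b] by rewrite in_itv/= lexx ltW.
  have : f x - psi x = f a - psi a := dirichlet_eq0 ab hrho DH1 D0 xab aab.
  by rewrite psia subr0 => <-; rewrite subrK.
exists P; split => // x xab; have dx := dpsi _ xab.
apply: (near_eq_is_derive (f := fun y => f a + psi y)).
  have := near_in_itvoo xab; apply: filterS => y yab.
  by apply/esym/fE; exact: subset_itv_oo_cc yab.
have := is_deriveD (is_derive_cst (f a) x (1 : R)) dx.
by rewrite add0r.
Qed.

End Regularity.

(** * Zeros and fluxes *)

Section SturmLiouville.
Context {R : realType}.
Variables (a b : R) (rho : R -> R).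
Hypothesis ab : a < b.
Hypothesis crho : {within `[a, b], continuous rho}.
Hypothesis rho_gt0 : forall x, x \in `[a, b] -> 0 < rho x.
Implicit Types (f g P Q : R -> R).

(** The equation (rho f')' = - rho g with natural boundary conditions, as a
    first-order system in f and the flux P = - rho f', which avoids
    differentiating rho. An eigenfunction is the case g = l f. *)
Definition flux_system f P g :=
  [/\ {within `[a, b], continuous f}, {within `[a, b], continuous P},
      P a = 0 /\ P b = 0,
      forall x, x \in `]a, b[ -> is_derive x 1 f (- P x / rho x) &
      forall x, x \in `]a, b[ -> is_derive x 1 P (rho x * g x)].

(** Gronwall: the energy f^2 + P^2 cannot leave zero. *)
Lemma unique_continuation f P (l z : R) : flux_system f P (l *: f) ->
  z \in `[a, b] -> f z = 0 -> P z = 0 -> forall x, x \in `[a, b] -> f x = 0.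
Proof.
move=> [cf cP _ df dP] zab fz Pz x xab.
have [c cab cmin] := EVT_min (ltW ab) crho.
have [d dab dmax] := EVT_max (ltW ab) crho.
have c0 := rho_gt0 cab.
(* E' = 2 f P (l rho - 1 / rho) <= C E, and symmetrically E' >= - C E. *)
pose C := `|l| * rho d + (rho c)^-1.
have Cb y : y \in `]a, b[ -> `|l * rho y - (rho y)^-1| <= C.
  move=> /subset_itv_oo_cc/= yab; apply: le_trans (ler_normB _ _) _.
  have ry := rho_gt0 yab; rewrite normrM (gtr0_norm ry) normfV (gtr0_norm ry).
  by rewrite lerD ?ler_wpM2l ?dmax ?lef_pV2 ?posrE ?cmin.
pose E y := f y * f y + P y * P y.
have cE : {within `[a, b], continuous E}.
  by apply: within_continuousD; exact: within_continuousM.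
have E0 y : 0 <= E y by rewrite /E -!expr2 addr_ge0 ?sqr_ge0.
pose dE y := 2 * f y * P y * (l * rho y - (rho y)^-1).
have dEE (y : R) : y \in `]a, b[ -> is_derive y 1 E (dE y).
  move=> yab; have d1 := df _ yab; have d2 := dP _ yab.
  apply: (is_derive_eq (is_deriveD (is_deriveM d1 d1) (is_deriveM d2 d2))).
  rewrite /dE /GRing.scale/= /GRing.scale/=.
  by field; rewrite gt_eqF// rho_gt0//; exact: subset_itv_oo_cc yab.
have dEb y : y \in `]a, b[ -> `|dE y| <= C * E y.
  move=> yab; rewrite /dE normrM mulrC.
  apply: ler_pM => //; first exact: Cb.
  rewrite /E ler_norml; apply/andP; split.
    by have := sqr_ge0 (f y + P y); nra.
  by have := sqr_ge0 (f y - P y); nra.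
have dG (k y : R) : y \in `]a, b[ ->
    is_derive y 1 (fun t => E t * expR (k * t)) ((dE y + k * E y) * expR (k * y)).
  move=> yab; have d1 := dEE _ yab.
  have d2 : is_derive y 1 (fun t => expR (k * t)) (k * expR (k * y)).
    have d3 : is_derive y 1 (fun t : R => k * t) k.
      have -> : (fun t : R => k * t) = k *: id by [].
      by apply: is_derive_eq; rewrite /GRing.scale/= mulr1.
    have := @is_derive1_comp _ expR (fun t => k * t) y _ _ (is_derive_expR _) d3.
    by rewrite mulrC.
  have -> : (fun t => E t * expR (k * t)) = E * (fun t => expR (k * t)) by [].
  by apply: is_derive_eq; rewrite /GRing.scale/=; ring.
have cG (k : R) : {within `[a, b], continuous (fun t => E t * expR (k * t))}.
  apply: within_continuousM => //; apply: continuous_subspaceT => y.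
  apply: (@continuous_comp _ _ _ (fun t => k * t) expR); last exact: continuous_expR.
  by apply: cvgM; [exact: cvg_cst|exact: cvg_id].
have Ez : E z = 0 by rewrite /E fz Pz !mulr0 addr0.
have Ex0 : E x = 0.
  have /andP[az zb] : a <= z <= b by move: zab; rewrite in_itv.
  have /andP[ax xb] : a <= x <= b by move: xab; rewrite in_itv.
  have [zx|/ltW xz] := leP z x.
    have := @ler0_derive1_nincr _ (fun t => E t * expR (- C * t)) a b.
    move=> /(_ _ _ (cG _) z x az zx xb); rewrite Ez mul0r.
    rewrite pmulr_lle0 ?expR_gt0// => H; apply/eqP; rewrite eq_le E0 andbT.
    apply: H => y yab; first by have [] := dG (- C) _ yab.
    rewrite derive1E; have [_ ->] := dG (- C) _ yab.
    rewrite pmulr_lle0 ?expR_gt0// mulNr subr_le0.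
    exact: le_trans (ler_norm _) (dEb _ yab).
  have := @ler0_derive1_nincr _ (fun t => - (E t * expR (C * t))) a b.
  have cN : {within `[a, b], continuous (fun t => - (E t * expR (C * t)))}.
    by move=> t; apply: cvgN; exact: cG.
  move=> /(_ _ _ cN x z ax xz zb); rewrite Ez mul0r oppr0 lerNr oppr0.
  rewrite pmulr_lle0 ?expR_gt0// => H; apply/eqP; rewrite eq_le E0 andbT.
  have dN (y : R) : y \in `]a, b[ -> is_derive y 1 (fun t => - (E t * expR (C * t)))
     (- ((dE y + C * E y) * expR (C * y))).
    by move=> yab; have := dG C _ yab => dy; exact: is_deriveN.
  apply: H => y yab; first by have [] := dN _ yab.
  rewrite derive1E; have [_ ->] := dN _ yab.
  rewrite oppr_le0 mulr_ge0 ?expR_ge0//.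
  by have := ler_norm (- dE y); have := dEb _ yab; rewrite normrN => ? ?; lra.
move: Ex0; rewrite /E -!expr2 => /eqP.
by rewrite paddr_eq0 ?sqr_ge0// sqrf_eq0 => /andP[/eqP].
Qed.

Definition increasing_zeros f (N : nat) (z : nat -> R) :=
  (forall i, (i < N)%N -> z i \in `[a, b] /\ f (z i) = 0) /\
  (forall i, (i.+1 < N)%N -> z i < z i.+1).

(** Rolle: f has a critical point between two of its zeros, and f' = - P / rho. *)
Lemma flux_interlace f P g N z : flux_system f P g -> increasing_zeros f N z ->
  exists y : nat -> R, forall i, (i.+1 < N)%N -> z i < y i < z i.+1 /\ P (y i) = 0.
Proof.
move=> [cf cP _ df dP] [fz zz].
suff : forall i, exists y, (i.+1 < N)%N -> z i < y < z i.+1 /\ P y = 0.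
  by move=> H; have [y yP] := choice H; exists y.
move=> i; have [iN|] := boolP (i.+1 < N)%N; last by exists 0.
have [] := fz _ iN; rewrite in_itv/= => /andP[az1 z1b] fz1.
have [] := fz _ (ltnW iN); rewrite in_itv/= => /andP[az0 z0b] fz0.
have oo y : y \in `](z i), (z i.+1)[ -> y \in `]a, b[.
  by rewrite !in_itv/= => /andP[zy yz]; rewrite (le_lt_trans az0 zy) (lt_le_trans yz z1b).
have [||y yz] := @Rolle _ f (z i) (z i.+1) (zz _ iN) _ _ (etrans fz0 (esym fz1)).
- by move=> y /oo /df[].
- by apply: continuous_subspaceW cf; apply: subset_itv; rewrite bnd_simp.
move=> [_ fy0]; exists y => _; split; first by move: yz; rewrite in_itv.
have [_] := df _ (oo _ yz); rewrite fy0 => /eqP.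
have ry : 0 < rho y by apply: rho_gt0; exact: subset_itv_oo_cc (oo _ yz).
by rewrite eq_sym mulf_eq0 invr_eq0 (gt_eqF ry) orbF oppr_eq0 => /eqP.
Qed.

(** Rolle twice: f has N zeros, so the flux has N - 1 interior zeros, hence
    N + 1 zeros counting its two boundary zeros, and P' = rho g has N. *)
Lemma flux_zeros f P g N z : flux_system f P g -> increasing_zeros f N z ->
  exists z', increasing_zeros g N z'.
Proof.
move=> sys zz; have [y yP] := flux_interlace sys zz.
have [cf cP [Pa Pb] df dP] := sys; have [fz zinc] := zz.
(* The N + 1 zeros of the flux: a, the Rolle points, b. *)
pose t j := if j is j'.+1 then if j == N then b else y j' else a.
have tz j : (j < N)%N -> t j <= z j.
  case: j => [|j] jN /=; first by have [] := fz _ jN; rewrite in_itv/= => /andP[].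
  by rewrite (ltn_eqF jN); have [/andP[_ /ltW]] := yP _ jN.
have zt j : (j < N)%N -> z j <= t j.+1.
  move=> jN /=; case: eqP => [_|/eqP jN1].
    by have [] := fz _ jN; rewrite in_itv/= => /andP[].
  by have [] // := yP j _; [rewrite ltn_neqAle jN1|move=> /andP[/ltW]].
have tt j : (j < N)%N -> t j < t j.+1.
  move=> jN; have := zt _ jN; rewrite le_eqVlt => /predU1P[zE|]; last first.
    exact: le_lt_trans (tz _ jN).
  case: j jN zE => [|j] jN zE.
    move: zE => /=; case: eqP => [_ _|/eqP N1 zE] //.
    by have [] := yP 0 _; [rewrite ltn_neqAle N1|rewrite -zE ltxx].
  rewrite -zE /= (ltn_eqF jN).
  by have [/andP[]] := yP _ jN.
have Pt j : (j <= N)%N -> P (t j) = 0.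
  case: j => [//|j] jN /=; case: eqP => [//|/eqP jN1].
  by have [] := yP j _ => //; rewrite ltn_neqAle jN1.
have tab j : (j <= N)%N -> a <= t j <= b.
  case: j => [_|j jN]; first by rewrite lexx ltW.
  have [] := fz _ jN; rewrite in_itv/= => /andP[az zb] _.
  have := zt _ jN; rewrite /=; case: eqP => [_ _|/eqP jN1 zy].
    by rewrite lexx ltW.
  rewrite (le_trans az zy)/=.
  have jN' : (j.+1 < N)%N by rewrite ltn_neqAle jN1.
  have [/andP[_ /ltW yz] _] := yP _ jN'; apply: le_trans yz _.
  by have [] := fz _ jN'; rewrite in_itv/= => /andP[].
suff : forall j, exists z', (j < N)%N -> t j < z' < t j.+1 /\ g z' = 0.
  move=> H; have [z' z'P] := choice H; exists z'; split=> [i iN|i iN].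
    have [/andP[z1 z2] gz] := z'P _ iN; split => //.
    have /andP[at1 _] := tab _ (ltnW iN); have /andP[_ tb] := tab _ iN.
    by rewrite in_itv/= (le_trans at1 (ltW z1)) (le_trans (ltW z2) tb).
  have [/andP[_ z1] _] := z'P _ (ltnW iN); have [/andP[z2 _] _] := z'P _ iN.
  exact: lt_trans z1 z2.
move=> j; have [jN|] := boolP (j < N)%N; last by exists 0.
have /andP[at1 _] := tab _ (ltnW jN); have /andP[_ tb] := tab _ jN.
have oo s : s \in `](t j), (t j.+1)[ -> s \in `]a, b[.
  by rewrite !in_itv/= => /andP[ts st]; rewrite (le_lt_trans at1 ts) (lt_le_trans st tb).
have [||s st] := @Rolle _ P (t j) (t j.+1) (tt _ jN) _ _ (etrans (Pt _ (ltnW jN)) (esym (Pt _ jN))).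
- by move=> s /oo /dP[].
- by apply: continuous_subspaceW cP; apply: subset_itv; rewrite bnd_simp.
move=> [_ Ps0]; exists s => _; split; first by move: st; rewrite in_itv.
have [_] := dP _ (oo _ st); rewrite Ps0 => /eqP.
have rs : 0 < rho s by apply: rho_gt0; exact: subset_itv_oo_cc (oo _ st).
by rewrite eq_sym mulf_eq0 (gt_eqF rs)/= => /eqP.
Qed.

End SturmLiouville.

(** * Zeros of eigenexpansions *)

Section Liouville.
Context {R : realType}.

(** Along an ultrafilter all sequences with values in a compact set converge at
    once, without extracting subsequences. *)
Lemma ultra_compact_cvg {T : topologicalType} {J : Type} (U : set_system J)
    (K : set T) (f : J -> T) : UltraFilter U -> compact K ->
  (forall j, K (f j)) -> exists l, K l /\ f @ U --> l.
Proof.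
move=> UU cK fK; have PU : ProperFilter U by exact: ultra_proper.
have [|l [Kl cl]] := cK (f @ U) _.
  by apply: nearW => j; exact: fK.
exists l; split=> // N Nl; have [//|UN] := in_ultra_setVsetC (f @^-1` N) UU.
by have [x [/= x1 x2]] := cl (~` N) N UN Nl.
Qed.

Variables (a b : R) (rho : R -> R).
Hypothesis ab : a < b.
Hypothesis crho : {within `[a, b], continuous rho}.
Hypothesis rho_gt0 : forall x, x \in `[a, b] -> 0 < rho x.
Implicit Types (f g P Q : R -> R).

Notation flux_system := (flux_system a b rho).
Notation increasing_zeros := (increasing_zeros a b).

Lemma flux_system0 : flux_system 0 0 0.
Proof.
split=> //; [by move=> x; exact: cvg_cst..| |].
- by move=> x _; rewrite oppr0 mul0r; exact: is_derive_cst.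
- by move=> x _; rewrite mulr0; exact: is_derive_cst.
Qed.

Lemma flux_system_lin (k : R) f P g f' P' g' : flux_system f P g ->
  flux_system f' P' g' ->
  flux_system (k *: f + f') (k *: P + P') (k *: g + g').
Proof.
move=> [cf cP [Pa Pb] df dP] [cf' cP' [Pa' Pb'] df' dP']; split.
- by move=> x; apply: cvgD; [apply: cvgZr; exact: cf|exact: cf'].
- by move=> x; apply: cvgD; [apply: cvgZr; exact: cP|exact: cP'].
- by rewrite !fctE Pa Pb Pa' Pb' !scaler0 !addr0.
- move=> x xab; apply: (is_derive_eq (is_deriveD (is_deriveZ k (df _ xab)) (df' _ xab))).
  by rewrite !fctE /GRing.scale/=; ring.
- move=> x xab; apply: (is_derive_eq (is_deriveD (is_deriveZ k (dP _ xab)) (dP' _ xab))).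
  by rewrite !fctE /GRing.scale/=; ring.
Qed.

Lemma flux_system_sum (n : nat) (c : nat -> R) (f P g : nat -> R -> R) :
  (forall m, flux_system (f m) (P m) (g m)) ->
  flux_system (\sum_(m < n) c m *: f m) (\sum_(m < n) c m *: P m)
              (\sum_(m < n) c m *: g m).
Proof.
move=> sys; elim: n => [|n IH]; first by rewrite !big_ord0; exact: flux_system0.
by rewrite !big_ord_recr/= ![_ + c n *: _]addrC; exact: flux_system_lin.
Qed.

Variables (phi P : nat -> R -> R) (lam : nat -> R).
Hypothesis sys : forall m, flux_system (phi m) (P m) (lam m *: phi m).
Hypothesis lam0 : lam 0%N = 0.
Hypothesis lam_inc : forall m, lam m < lam m.+1.

Let lam_mono m n : (m < n)%N -> lam m < lam n.
Proof.
elim: n => // n IH; rewrite ltnS leq_eqVlt => /predU1P[->//|/IH H].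
exact: lt_trans H _.
Qed.

Lemma lam_ge0 m : 0 <= lam m.
Proof. by case: m => [|m]; rewrite -lam0// ltW// lam_mono. Qed.

(** Multiplying each coefficient by lam m amounts to applying the
    differential operator, which loses no zeros by flux_zeros. *)
Lemma zeros_iterate n (c : nat -> R) N (z : nat -> R) :
  increasing_zeros (\sum_(m < n) c m *: phi m) N z ->
  forall k, exists z',
    increasing_zeros (\sum_(m < n) (c m * lam m ^+ k) *: phi m) N z'.
Proof.
move=> zz; elim=> [|k [z' zz']].
  by exists z; under eq_bigr do rewrite expr0 mulr1.
have := flux_system_sum n (fun m => c m * lam m ^+ k) sys.
move=> /(flux_zeros ab rho_gt0)/(_ zz')[z'' zz'']; exists z''.
by under eq_bigr do rewrite exprSr mulrA -scalerA.
Qed.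

(** The iterates, rescaled by lam p, converge to c p phi p, and their zeros
    converge along an ultrafilter to zeros of phi p. Two limits cannot
    coincide: the flux has a zero between consecutive zeros, so phi p and its
    flux would vanish at the same point, against unique continuation. *)
Lemma zeros_top p (c : nat -> R) N (z : nat -> R) :
  (exists2 x, x \in `[a, b] & phi p x <> 0) ->
  c p <> 0 -> increasing_zeros (\sum_(m < p.+1) c m *: phi m) N z ->
  exists z', increasing_zeros (phi p) N z'.
Proof.
(* As lam 0 = 0, rescaling by lam p requires p > 0. *)
case: p => [|p] [x0 x0ab phix0] cp0 zz.
  exists z; case: zz => zz zi; split => // i /zz[zab]; rewrite big_ord1 => cz.
  split=> //; move: cz; rewrite [X in X = _]/(c 0%N * _) => /eqP.
  by rewrite mulf_eq0 => /orP[/eqP//|/eqP].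
have lp0 : 0 < lam p.+1 by rewrite -lam0 lam_mono.
pose r m := lam m / lam p.+1.
pose ck k m := c m * r m ^+ k.
have zk k : exists zy : (nat -> R) * (nat -> R),
    increasing_zeros (\sum_(m < p.+2) ck k m *: phi m) N zy.1 /\
    forall i, (i.+1 < N)%N -> zy.1 i < zy.2 i < zy.1 i.+1 /\
      (\sum_(m < p.+2) ck k m *: P m) (zy.2 i) = 0.
  have [z' [zz' zi']] := zeros_iterate zz k.
  have zz'' : increasing_zeros (\sum_(m < p.+2) ck k m *: phi m) N z'.
    split=> // i /zz'[zab fz]; split => //.
    move: fz; rewrite !lincombE => fz.
    move/(congr1 ( *%R ((lam p.+1)^-1 ^+ k))) : fz; rewrite mulr0 => fz.
    rewrite -[RHS]fz mulr_sumr; apply: eq_bigr => m _; rewrite /ck /r exprMn; ring.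
  have [y yP] := flux_interlace rho_gt0 (flux_system_sum p.+2 (ck k) sys) zz''.
  by exists (z', y).
have [ZY ZYP] := choice zk.
have [U [UU subU]] := ultraFilterLemma (eventually_filter).
have PU : ProperFilter U by exact: ultra_proper.
pose cl x := clamp a b x.
have clab x : `[a, b]%classic (cl x) by rewrite /= in_itv/= clamp_itv// ltW.
have limZ i : exists l, `[a, b]%classic l /\ cl ((ZY k).1 i) @[k --> U] --> l.
  by apply: ultra_compact_cvg => //; exact: segment_compact.
have limY i : exists l, `[a, b]%classic l /\ cl ((ZY k).2 i) @[k --> U] --> l.
  by apply: ultra_compact_cvg => //; exact: segment_compact.
have rcvg m : (m < p.+2)%N -> r m ^+ k @[k --> U] --> ((m == p.+1)%:R : R).
  move=> mp; apply: (@cvg_trans _ (r m ^+ k @[k --> \oo])).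
    by move=> A /subU.
  case: eqP => [->|/eqP mp1].
    apply: cvg_near_cst; apply: nearW => k.
    by rewrite /r divff ?expr1n// gt_eqF.
  apply: cvg_expr; rewrite /r ger0_norm ?divr_ge0 ?lam_ge0//.
  by rewrite ltr_pdivrMr// mul1r lam_mono// ltn_neqAle mp1 -ltnS.
have limf (u : nat -> R -> R) (s : nat -> R) l :
    (forall m, {within `[a, b], continuous (u m)}) ->
    `[a, b]%classic l -> cl (s k) @[k --> U] --> l ->
    (forall k, s k \in `[a, b]) ->
    (forall k, (\sum_(m < p.+2) ck k m *: u m) (s k) = 0) -> u p.+1 l = 0.
  move=> cu lab sl sab us.
  have cvgu m : u m (s k) @[k --> U] --> u m l.
    have lE : u m l = u m (cl l) by rewrite /cl clamp_id//; move: lab; rewrite /= in_itv.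
    rewrite lE.
    have -> : (fun k => u m (s k)) = (fun x => u m (cl x)) \o (fun k => cl (s k)).
      have sid k : clamp a b (s k) = s k.
        by apply: clamp_id; have := sab k; rewrite in_itv.
      by apply/funext => k; rewrite /= /cl !sid.
    apply: (cvg_comp _ _ sl).
    have cum : continuous (fun x => u m (cl x)) := continuous_clamp (ltW ab) (cu m).
    exact: cum.
  have : \sum_(m < p.+2) ck k m * u m (s k) @[k --> U] -->
         \sum_(m < p.+2) c m * (nat_of_ord m == p.+1)%:R * u m l.
    apply: cvg_big => [|m _]; first exact: add_continuous.
    apply: cvgM; last exact: cvgu.
    by apply: cvgM; [exact: cvg_cst|exact: rcvg].
  have -> : (fun k => \sum_(m < p.+2) ck k m * u m (s k)) = cst 0.
    by apply/funext => k; have := us k; rewrite lincombE; apply.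
  move=> lim0.
  have : \sum_(m < p.+2) c m * (nat_of_ord m == p.+1)%:R * u m l = 0.
    by apply: (cvg_unique _ lim0) => //; exact: cvg_cst.
  rewrite big_ord_recr/= big1 => [|m _]; last first.
    by rewrite ltn_eqF// mulr0 mul0r.
  rewrite add0r eqxx mulr1 => /eqP; rewrite mulf_eq0 => /orP[/eqP//|/eqP//].
have [Z ZP] := choice limZ; have [Y YP] := choice limY.
have ZYab k i : (i < N)%N -> (ZY k).1 i \in `[a, b].
  by move=> iN; have [[/(_ _ iN)[]]] := ZYP k.
have YYab k i : (i.+1 < N)%N -> (ZY k).2 i \in `[a, b].
  move=> iN; have [_ /(_ _ iN)[/andP[zy yz] _]] := ZYP k.
  have := ZYab k _ iN; have := ZYab k _ (ltnW iN); rewrite !in_itv/=.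
  by move=> /andP[az _] /andP[_ zb]; rewrite (le_trans az (ltW zy)) (le_trans (ltW yz) zb).
have phiZ i : (i < N)%N -> phi p.+1 (Z i) = 0.
  move=> iN; have [Zab Zl] := ZP i.
  apply: limf Zab Zl _ _; first by move=> m; case: (sys m).
    by move=> k; exact: ZYab.
  by move=> k; have [[/(_ _ iN)[]]] := ZYP k.
exists Z; split=> [i iN|i iN].
  by split; [case: (ZP i)|exact: phiZ].
have PY : P p.+1 (Y i) = 0.
  have [Yab Yl] := YP i.
  apply: limf Yab Yl _ _; first by move=> m; case: (sys m).
    by move=> k; exact: YYab.
  by move=> k; have [_ /(_ _ iN)[]] := ZYP k.
have cl_id x : x \in `[a, b] -> cl x = x.
  by rewrite in_itv => xab; rewrite /cl clamp_id.
have ZY1 : Z i <= Y i.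
  apply: ler_cvg_to (ZP i).2 (YP i).2 _; apply: nearW => k.
  rewrite !cl_id ?YYab ?ZYab ?(ltnW iN)//.
  by have [_ /(_ _ iN)[/andP[/ltW]]] := ZYP k.
have YZ1 : Y i <= Z i.+1.
  apply: ler_cvg_to (YP i).2 (ZP i.+1).2 _; apply: nearW => k.
  rewrite !cl_id ?YYab ?ZYab//.
  by have [_ /(_ _ iN)[/andP[_ /ltW]]] := ZYP k.
rewrite lt_neqAle (le_trans ZY1 YZ1) andbT; apply/eqP => ZZ.
have YZ : Y i = Z i by apply/eqP; rewrite eq_le ZY1 andbT ZZ.
apply: phix0.
have := unique_continuation ab crho rho_gt0 (sys p.+1) (ZP i).1 (phiZ _ (ltnW iN)).
by apply=> //; rewrite -YZ.
Qed.

End Liouville.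

(** * The Chebyshev property of the eigenfunctions *)

Section PoincareBasisTheory.
Context {R : realType}.
Variables (a b : R) (mu : probability (measurableTypeR R) R) (rho : R -> R).
Hypothesis ab : a < b.
Hypothesis hrho : is_density a b mu rho.
Implicit Types (f g h u : R -> R).

Notation L2 := (L2 a b mu).
Notation L2_inner := (L2_inner a b mu).
Notation in_H1 := (in_H1 a b mu).
Notation wderiv := (wderiv a b).
Notation dirichlet := (dirichlet a b mu).
Notation flux_system := (flux_system a b rho).
Notation increasing_zeros := (increasing_zeros a b).

Let crho : {within `[a, b], continuous rho}. Proof. by case: hrho. Qed.

Let rho_gt0 x : x \in `[a, b] -> 0 < rho x.
Proof. by case: hrho => _ + _; exact. Qed.

Lemma Rintegral_eq0 h : (forall x, x \in `[a, b] -> h x = 0) ->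
  \int[mu]_(x in `[a, b]) h x = 0.
Proof.
move=> h0; transitivity (\int[mu]_(x in `[a, b]) (cst 0 x : R)).
  by apply: eq_Rintegral => x /set_mem; exact: h0.
by rewrite Rintegral_cst// mul0r.
Qed.

Variables (phi : nat -> R -> R) (lam : nat -> R).
Hypothesis basis : poincare_basis a b mu phi lam.

Lemma phi_H1 m : in_H1 (phi m).
Proof. by case: basis => /(_ m)[]. Qed.

Lemma phi_eigen m g : in_H1 g -> dirichlet (phi m) g = lam m * L2_inner (phi m) g.
Proof. by case: basis => /(_ m)[_ +] _ _ _ _; exact. Qed.

Lemma phi_orthonormal i j : L2_inner (phi i) (phi j) = (i == j)%:R.
Proof. by case: basis => _ _ _ + _; exact. Qed.

Lemma lam_0 : lam 0%N = 0.
Proof. by case: basis => _ []. Qed.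

Lemma lam_lt m : lam m < lam m.+1.
Proof. by case: basis => _ []. Qed.

Lemma lam_mono m n : (m < n)%N -> lam m < lam n.
Proof.
elim: n => // n IH; rewrite ltnS leq_eqVlt => /predU1P[->|/IH H].
  exact: lam_lt.
exact: lt_trans H (lam_lt _).
Qed.

(** Regularity gives the eigenfunctions as solutions of flux systems. *)
Lemma phi_flux : exists P : nat -> R -> R,
  forall m, flux_system (phi m) (P m) (lam m *: phi m).
Proof.
suff : forall m, exists P, flux_system (phi m) P (lam m *: phi m).
  by move=> H; have [P sys] := choice H; exists P.
move=> m; have eig : poincare_eigenpair a b mu (phi m) (lam m) by case: basis.
have [P [Pa Pb cP dP dphi]] := eigen_regular ab hrho eig.
exists P; split => //; first exact: in_H1_continuous (phi_H1 m).
move=> x xab; apply: (is_derive_eq (dP _ xab)).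
by rewrite fctE /GRing.scale/=; ring.
Qed.

Lemma phi_neq0 m : exists2 x, x \in `[a, b] & phi m x <> 0.
Proof.
apply: contrapT => H.
have phi0 x : x \in `[a, b] -> phi m x = 0.
  by move=> xab; apply: contrapT => p0; apply: H; exists x.
have := phi_orthonormal m m; rewrite eqxx /Defs.L2_inner.
rewrite Rintegral_eq0 => [/esym/eqP|x xab]; first by rewrite oner_eq0.
by rewrite phi0// mul0r.
Qed.

Let hA := L2_prehilbert ab hrho.
Let hB := dirichlet_prehilbert ab hrho.

(** Let c m be the Fourier coefficients of u. Bessel's inequality for the
    Dirichlet form and Parseval's identity for L^2 give
    sum_m (lam m - lam p) c m ^2 <= 0, where the terms with m < p are zero and
    those with m > p are nonnegative; so only c p can be nonzero. *)
Lemma rayleigh_eq p u : in_H1 u ->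
  (forall m, (m < p)%N -> L2_inner u (phi m) = 0) ->
  dirichlet u u <= lam p * L2_inner u u ->
  let v := u - L2_inner u (phi p) *: phi p in L2_inner v v = 0.
Proof.
move=> uH1 up ray v.
pose c m := L2_inner u (phi m).
pose S N : R -> R := \sum_(m < N) c m *: phi m.
have SH1 N : in_H1 (S N) by apply: (carrier_sum hA) => i; exact: phi_H1.
have uSH1 N : in_H1 (u - S N) by exact: (carrierB hA uH1 (SH1 N)).
pose e N := L2_inner (u - S N) (u - S N).
have e0 N : 0 <= e N by exact: (inner_ge0 hA (uSH1 N)).
have ecvg : e N @[N --> \oo] --> 0.
  have lim0 : L2_norm a b mu (u - S N) @[N --> \oo] --> 0.
    case: basis => _ _ _ _ H; apply: H; exact: in_H1_L2.
  have -> : e = (fun N => L2_norm a b mu (u - S N) * L2_norm a b mu (u - S N)).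
    by apply/funext => N; rewrite -expr2 sqr_sqrtr//; exact: e0.
  by rewrite -(mulr0 0); exact: cvgM.
have AS N g : in_H1 g ->
    L2_inner (S N) g = \sum_(m < N) c m * L2_inner (phi m) g.
  exact: (inner_suml hA (index_enum 'I_N) xpredT c (fun m : 'I_N => phi_H1 m)).
have BS N g : in_H1 g ->
    dirichlet (S N) g = \sum_(m < N) c m * dirichlet (phi m) g.
  exact: (inner_suml hB (index_enum 'I_N) xpredT c (fun m : 'I_N => phi_H1 m)).
have AuS N : L2_inner u (S N) = \sum_(m < N) c m ^+ 2.
  rewrite L2_innerC AS//; apply: eq_bigr => m _.
  by rewrite [L2_inner _ u]L2_innerC expr2.
have ASphi N j : (j < N)%N -> L2_inner (S N) (phi j) = c j.
  move=> jN; rewrite AS; last exact: phi_H1.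
  rewrite (bigD1 (Ordinal jN))//= phi_orthonormal eqxx mulr1 big1 ?addr0// => m mj.
  rewrite phi_orthonormal; case: eqP => [E|]; last by rewrite mulr0.
  by case/negP: mj; apply/eqP/val_inj.
have ASS N : L2_inner (S N) (S N) = \sum_(m < N) c m ^+ 2.
  rewrite AS//; apply: eq_bigr => m _.
  by rewrite L2_innerC ASphi// expr2.
have eE N : e N = L2_inner u u - \sum_(m < N) c m ^+ 2.
  rewrite /e; have /= -> := innerBl hA uH1 (SH1 N) (uSH1 N).
  rewrite [L2_inner u _]L2_innerC [L2_inner (S N) _]L2_innerC.
  have /= -> := innerBl hA uH1 (SH1 N) uH1.
  have /= -> := innerBl hA uH1 (SH1 N) (SH1 N).
  by rewrite [L2_inner (S N) u]L2_innerC AuS ASS; ring.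
have BSu N g : in_H1 g -> dirichlet (S N) g = \sum_(m < N) lam m * (c m * L2_inner (phi m) g).
  move=> gH1; rewrite BS//.
  by apply: eq_bigr => m _; rewrite phi_eigen//; ring.
have Bge N : \sum_(m < N) lam m * c m ^+ 2 <= dirichlet u u.
  have := inner_ge0 hB (uSH1 N) => /=.
  have /= -> := innerBl hB uH1 (SH1 N) (uSH1 N).
  have /= -> := inner_sym hB uH1 (uSH1 N).
  have /= -> := inner_sym hB (SH1 N) (uSH1 N).
  have /= -> := innerBl hB uH1 (SH1 N) uH1.
  have /= -> := innerBl hB uH1 (SH1 N) (SH1 N).
  have /= -> := inner_sym hB uH1 (SH1 N).
  have -> : dirichlet (S N) u = \sum_(m < N) lam m * c m ^+ 2.
    rewrite BSu//; apply: eq_bigr => m _.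
    by rewrite L2_innerC -/(c m) expr2.
  have -> : dirichlet (S N) (S N) = \sum_(m < N) lam m * c m ^+ 2.
    rewrite BSu//; apply: eq_bigr => m _.
    by rewrite L2_innerC ASphi// expr2.
  by rewrite subrr subr0 subr_ge0.
have gap N : \sum_(m < N) (lam m - lam p) * c m ^+ 2 <= lam p * e N.
  rewrite (eq_bigr (fun m : 'I_N => lam m * c m ^+ 2 - lam p * c m ^+ 2)); last first.
    by move=> m _; rewrite mulrBl.
  rewrite sumrB -mulr_sumr eE mulrBr lerD2r.
  exact: le_trans (Bge N) ray.
have term0 m : 0 <= (lam m - lam p) * c m ^+ 2.
  have [mp|] := ltnP m p; first by rewrite /c up// expr0n/= mulr0.
  rewrite leq_eqVlt => /predU1P[<-|pm]; first by rewrite subrr mul0r.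
  by rewrite mulr_ge0 ?sqr_ge0// subr_ge0 ltW// lam_mono.
have c0 q : q != p -> c q = 0.
  move=> qp; have [|pq] := ltnP q p; first exact: up.
  have {}pq : (p < q)%N by rewrite ltn_neqAle eq_sym qp.
  have bound : (lam q - lam p) * c q ^+ 2 <= 0.
    have lim : lam p * e N @[N --> \oo] --> 0.
      by rewrite -(mulr0 (lam p)); apply: cvgM => //; exact: cvg_cst.
    apply: (ler_cvg_to (@cvg_cst _ _ _ \oo _) lim).
    near=> N; have qN : (q < N)%N by near: N; exact: nbhs_infty_gt.
    apply: le_trans (gap N); rewrite (bigD1 (Ordinal qN))//= lerDl.
    by apply: sumr_ge0 => m _; exact: term0.
  have cq : c q ^+ 2 <= 0.
    by move: bound; rewrite pmulr_rle0// subr_gt0 lam_mono.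
  by apply/eqP; rewrite -sqrf_eq0 eq_le cq sqr_ge0.
have eN N : (p < N)%N -> e N = L2_inner v v.
  move=> pN; rewrite /e /v; have -> // : S N = L2_inner u (phi p) *: phi p.
  rewrite /S (bigD1 (Ordinal pN))//= big1 ?addr0// => m mp.
  rewrite c0 ?scale0r//; apply: contra mp => /eqP mp; exact/eqP/val_inj.
have lim : e N @[N --> \oo] --> L2_inner v v.
  apply: cvg_near_cst; near=> N; apply: eN; near: N; exact: nbhs_infty_gt.
exact: (cvg_unique _ lim ecvg).
Unshelve. all: by end_near. Qed.

(** Courant's nodal argument: if phi p had p + 1 zeros, its p + 2 nodal pieces
    would all have Rayleigh quotient lam p, and a nontrivial combination of the
    first p + 1 of them would be orthogonal to phi 0, ..., phi (p - 1), hence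
    a multiple of phi p, although it vanishes on the last piece. *)
Lemma courant p z : ~ increasing_zeros (phi p) p.+1 z.
Proof.
move=> [fz zz]; have [P sys] := phi_flux.
pose f := phi p; have fH1 : in_H1 f := phi_H1 p.
have cf := in_H1_continuous fH1.
have [_ cP [Pa Pb] df dP] := sys p.
have no_common x : x \in `[a, b] -> f x = 0 -> P p x = 0 -> False.
  move=> xab fx Px; have [y yab] := phi_neq0 p; apply.
  exact: (unique_continuation ab crho rho_gt0 (sys p) xab fx Px yab).
have zab i : (i < p.+1)%N -> a < z i < b.
  move=> ip; have [] := fz _ ip; rewrite in_itv/= => zi fzi.
  have /andP[az zb] := zi; rewrite !lt_neqAle az zb !andbT; apply/andP; split.
    apply/eqP => E; apply: (no_common a); rewrite ?in_itv/= ?lexx ?ltW//.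
    by rewrite E.
  apply/eqP => E; apply: (no_common b); rewrite ?in_itv/= ?lexx ?ltW//.
  by rewrite -E.
(* The zeros lie inside ]a, b[ and cut [a, b] into p + 2 pieces. *)
pose t j := if j is j'.+1 then if j == p.+2 then b else z j' else a.
have t_int j : (0 < j < p.+2)%N -> a < t j < b /\ f (t j) = 0.
  case: j => // j /= jp; rewrite (ltn_eqF jp); split; first exact: zab.
  by have [] := fz j jp.
have t0 : t 0%N = a by [].
have tp2 : t p.+2 = b by rewrite /t eqxx.
have tt j : (j < p.+2)%N -> t j < t j.+1.
  case: j => [_|j jp]; first by have [|/andP[]] := t_int 1%N.
  rewrite ltnS in jp; have [jp1|jp1] := eqVneq j p.
    by rewrite jp1 tp2; have [|/andP[]] := t_int p.+1; rewrite ?leqnn.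
  have jlp : (j < p)%N by rewrite ltn_neqAle jp1 -ltnS.
  rewrite /t !eqSS (ltn_eqF jlp) (ltn_eqF (leqW jlp)); apply: zz.
  by rewrite ltnS.
have tle i j : (i <= j)%N -> (j <= p.+2)%N -> t i <= t j.
  move=> + jp; elim: j jp => [_|j IH jp]; first by rewrite leqn0 => /eqP->.
  rewrite leq_eqVlt => /predU1P[->//|]; rewrite ltnS => ij.
  by apply: le_trans (IH (ltnW jp) ij) _; rewrite ltW// tt.
have tab j : (j <= p.+2)%N -> a <= t j <= b.
  by move=> jp; rewrite -{1}t0 -tp2 !tle.
clearbody t.
pose u j : R -> R := f \_ `[t j, t j.+1].
pose w j : R -> R := wderiv f \_ `]t j, t j.+1[.
have van j : (j < p.+2)%N -> vanishing_at_interior_ends a b (t j) (t j.+1) f.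
  move=> jp; split.
    case: j jp => [|j] jp; first by left.
    by right; have [] := t_int j.+1.
  have [->|jp1] := eqVneq j p.+1; first by left.
  right; have [] // := t_int j.+1; rewrite /= ltn_neqAle jp andbT.
  by rewrite eqSS.
have wu j : (j < p.+2)%N -> weak_derivative a b (u j) (w j).
  move=> jp; have /andP[at1 _] := tab _ (ltnW jp); have /andP[_ tb] := tab _ jp.
  exact: (trunc_weak_derivative ab at1 (tt _ jp) tb (van _ jp) cf
    (wderiv_integrable ab hrho fH1) (wderiv_weak_ibp fH1)).
have Lw j : L2 (w j) by apply: L2_trunc => //; exact: (wderiv_L2 ab hrho).
have uH1 j : (j < p.+2)%N -> in_H1 (u j).
  move=> jp; have /andP[at1 _] := tab _ (ltnW jp); have /andP[_ tb] := tab _ jp.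
  apply: in_H1_intro (wu _ jp) (Lw _).
  by apply: trunc_continuous => //; [rewrite at1 ltW// tt|exact: van].
have Auu i j : (i < j)%N -> (j < p.+2)%N -> L2_inner (u i) (u j) = 0.
  move=> ij jp; apply: Rintegral_eq0 => x _; rewrite /u !patchE.
  case: ifPn => [/set_mem/= xi|_]; last by rewrite mul0r.
  case: ifPn => [/set_mem/= xj|_]; last by rewrite mulr0.
  move: xi xj; rewrite !in_itv/= => /andP[_ xti] /andP[tjx _].
  have -> : x = t j.
    by apply/eqP; rewrite eq_le tjx andbT (le_trans xti)// tle// ltnW.
  have [|_ ->] := t_int j; last by rewrite mul0r.
  by rewrite jp andbT (leq_ltn_trans _ ij).
have Afu j : L2_inner f (u j) = L2_inner (u j) (u j).
  apply: eq_Rintegral => x _; rewrite /u patchE; case: ifPn => //.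
  by rewrite !mulr0.
have Buu i j : (i < j)%N -> (j < p.+2)%N -> dirichlet (u i) (u j) = 0.
  move=> ij jp; have ip := ltn_trans ij jp.
  rewrite (dirichletE ab hrho (uH1 _ ip) (uH1 _ jp) (wu _ ip) (wu _ jp)).
  apply: Rintegral_eq0 => x _; rewrite /w !patchE.
  case: ifPn => [/set_mem/= xi|_]; last by rewrite mul0r.
  case: ifPn => [/set_mem/= xj|_]; last by rewrite mulr0.
  move: xi xj; rewrite !in_itv/= => /andP[_ xti] /andP[tjx _].
  have := lt_trans tjx xti; rewrite ltNge tle//; exact: ltnW.
have Bu j : (j < p.+2)%N -> dirichlet (u j) (u j) = lam p * L2_inner (u j) (u j).
  move=> jp; rewrite -Afu -(phi_eigen p (uH1 _ jp)).
  rewrite (dirichletE ab hrho (uH1 _ jp) (uH1 _ jp) (wu _ jp) (wu _ jp)).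
  rewrite (dirichletE ab hrho fH1 (uH1 _ jp) (wderivP fH1) (wu _ jp)).
  apply: eq_Rintegral => x _; rewrite /w patchE; case: ifPn => //.
  by rewrite !mulr0.
(* p linear conditions on p + 1 coefficients. *)
pose A := \matrix_(i < p.+1, m < p) L2_inner (u i) (phi m).
have [d dA dn0] : exists2 d : 'rV_p.+1, d *m A = 0 & d != 0.
  have : kermx A != 0.
    by rewrite kermx_eq0 -row_leq_rank -ltnNge ltnS rank_leq_col.
  by move=> /rowV0Pn[d /sub_kermxP dA dn0]; exists d.
pose D j : R := if insub j is Some i then d 0 i else 0.
have Dd (i : 'I_p.+1) : D i = d 0 i by rewrite /D valK.
have Dp : D p.+1 = 0 by rewrite /D insubN// ltnn.
pose U : R -> R := \sum_(j < p.+2) D j *: u j.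
have uH1' (j : 'I_p.+2) : in_H1 (u j) by exact: uH1.
have UH1 : in_H1 U by apply: (carrier_sum hA) => j; exact: uH1'.
have AU g : in_H1 g -> L2_inner U g = \sum_(j < p.+2) D j * L2_inner (u j) g.
  exact: (@inner_suml _ _ hA _ (index_enum 'I_p.+2) xpredT (fun j => D j)
    (fun j => u j) g uH1').
have BU g : in_H1 g -> dirichlet U g = \sum_(j < p.+2) D j * dirichlet (u j) g.
  exact: (@inner_suml _ _ hB _ (index_enum 'I_p.+2) xpredT (fun j => D j)
    (fun j => u j) g uH1').
have AUu j : (j < p.+2)%N -> L2_inner U (u j) = D j * L2_inner (u j) (u j).
  move=> jp; rewrite AU; last exact: uH1.
  rewrite (bigD1 (Ordinal jp))//= big1 ?addr0// => i ij.
  have {}ij : nat_of_ord i != j by apply: contra ij => /eqP E; exact/eqP/val_inj.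
  move: ij; rewrite neq_ltn => /orP[ij|ji]; first by rewrite Auu// mulr0.
  by rewrite L2_innerC Auu// mulr0.
have BUu j : (j < p.+2)%N -> dirichlet U (u j) = lam p * (D j * L2_inner (u j) (u j)).
  move=> jp; rewrite BU; last exact: uH1.
  rewrite (bigD1 (Ordinal jp))//= big1 ?addr0 => [|i ij]; first by rewrite Bu//; ring.
  have {}ij : nat_of_ord i != j by apply: contra ij => /eqP E; exact/eqP/val_inj.
  move: ij; rewrite neq_ltn => /orP[ij|ji]; first by rewrite Buu// mulr0.
  by rewrite [dirichlet _ _]L2_innerC -/(dirichlet _ _) Buu// mulr0.
have Uorth m : (m < p)%N -> L2_inner U (phi m) = 0.
  move=> mp; rewrite AU; last exact: phi_H1.
  rewrite big_ord_recr/= Dp mul0r addr0.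
  have /matrixP/(_ 0 (Ordinal mp)) := dA; rewrite !mxE => dA0; rewrite -[RHS]dA0.
  by apply: eq_bigr => i _; rewrite mxE Dd.
have Uray : dirichlet U U <= lam p * L2_inner U U.
  rewrite le_eqVlt; apply/orP; left; apply/eqP.
  rewrite BU// AU// mulr_sumr; apply: eq_bigr => j _.
  rewrite [dirichlet (u j) U]L2_innerC -/(dirichlet _ _) [L2_inner (u j) U]L2_innerC.
  by rewrite BUu// AUu//; ring.
have := rayleigh_eq UH1 Uorth Uray; set cU := L2_inner U (phi p).
set v := U - _; move=> v0.
(* The coefficients D are not all equal, since D (p + 1) = 0. *)
have [j jp Dj] : exists2 j, (j < p.+2)%N & D j != cU.
  have [c0|c0] := eqVneq cU 0; last by exists p.+1; rewrite // Dp eq_sym.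
  have /matrix0Pn[i0 [i]] := dn0; rewrite ord1 => di.
  by exists i; [exact: ltnW (ltn_ord i)|rewrite Dd c0].
have vH1 : in_H1 v by exact: (carrierB hA UH1 (carrierZ hA cU fH1)).
have Nj : L2_inner (u j) (u j) = 0.
  have := cauchy_schwarz hA vH1 (uH1 _ jp); rewrite /= v0 mul0r => vu.
  have {}vu : L2_inner v (u j) = 0 by apply/eqP; rewrite -sqrf_eq0 eq_le vu sqr_ge0.
  move: vu; have /= -> := innerBl hA UH1 (carrierZ hA cU fH1) (uH1 _ jp).
  have /= -> := innerZl hA cU fH1 (uH1 _ jp).
  rewrite AUu// Afu -mulrBl => /eqP; rewrite mulf_eq0 subr_eq0 (negPf Dj)/=.
  by move/eqP.
have Bj0 : dirichlet (u j) (u j) = 0 by rewrite Bu// Nj mulr0.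
have /andP[atj _] := tab _ (ltnW jp); have /andP[_ tjb] := tab _ jp.
have ttj := tt _ jp.
have uj0 x : x \in `[a, b] -> u j x = 0.
  have [s sab us] : exists2 s, s \in `[a, b] & u j s = 0.
    case: (posnP j) => [j0|j0].
      have [|/andP[as1 sb] fs] := t_int 1%N; first by [].
      exists (t 1%N); first by rewrite in_itv/= !ltW.
      by rewrite /u patchE; case: ifPn.
    have [|/andP[as1 sb] fs] := t_int j; first by rewrite j0.
    exists (t j); first by rewrite in_itv/= !ltW.
    by rewrite /u patchE; case: ifPn.
  by move=> xab; rewrite -us; exact: (dirichlet_eq0 ab hrho (uH1 _ jp) Bj0).
have fj0 x : x \in `](t j), (t j.+1)[ -> f x = 0.
  move=> xt; have := uj0 x; rewrite /u patchE mem_set/=; last first.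
    exact: subset_itv_oo_cc.
  apply; move: xt; rewrite !in_itv/= => /andP[tx xt].
  by rewrite (le_trans atj (ltW tx)) (le_trans (ltW xt) tjb).
pose x := (t j + t j.+1) / 2.
have xt : x \in `](t j), (t j.+1)[ by rewrite in_itv/= !midf_lt.
have xab : x \in `]a, b[.
  by move: xt; rewrite !in_itv/= => /andP[/(le_lt_trans atj)-> /lt_le_trans->].
have rx : rho x != 0.
  by rewrite gt_eqF//; apply: rho_gt0; exact: subset_itv_oo_cc xab.
apply: (no_common x); [exact: subset_itv_oo_cc|exact: fj0|].
have [_] := df _ xab; rewrite derive_near0.
  by move=> /esym/eqP; rewrite mulf_eq0 invr_eq0 (negPf rx) orbF oppr_eq0 => /eqP.
by have := near_in_itvoo xt; apply: filterS => y; exact: fj0.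
Qed.

(** If the top coefficient were nonzero, zeros_top would give phi n too many
    zeros for courant; so it vanishes, and induction applies. *)
Lemma chebyshev n (c : nat -> R) z :
  increasing_zeros (\sum_(m < n) c m *: phi m) n z ->
  forall m, (m < n)%N -> c m = 0.
Proof.
elim: n => // n IH zz m mn.
have cn : c n = 0.
  apply: contrapT => cn; have [P sys] := phi_flux.
  have [z' zz'] := zeros_top ab crho rho_gt0 sys lam_0 lam_lt (phi_neq0 n) cn zz.
  exact: courant zz'.
move: mn; rewrite ltnS leq_eqVlt => /predU1P[->//|].
apply: IH; case: zz => z0 zi; split=> i ip; last exact: zi (leqW ip).
have [zab] := z0 i (leqW ip); split => //.
by move: b0; rewrite big_ord_recr/= cn scale0r addr0.
Qed.

(** A left null vector of the matrix is an eigenexpansion that vanishes at all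
    the nodes; sorting the nodes turns it into increasing zeros. *)
Lemma chebyshev_unitmx n (X : 'I_n -> R) :
  injective X -> (forall i, X i \in `[a, b]) ->
  \matrix_(m < n, i < n) phi m (X i) \in unitmx.
Proof.
move=> injX XI; set F := \matrix_(m, i) _.
rewrite -row_free_unit -kermx_eq0; apply/eqP/row_matrixP => k; rewrite row0.
have : row k (kermx F) *m F = 0 by rewrite -row_mul mulmx_ker row0.
move: (row k _) => c cF.
pose cn j : R := if insub j is Some i then c 0 i else 0.
have cnc (i : 'I_n) : cn i = c 0 i by rewrite /cn valK.
have f0 i : (\sum_(m < n) cn m *: phi m) (X i) = 0.
  rewrite lincombE; have /matrixP/(_ 0 i) := cF; rewrite !mxE => cF0.
  by rewrite -[RHS]cF0; apply: eq_bigr => m _; rewrite mxE cnc.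
pose s := sort <=%R [seq X i | i : 'I_n].
have szs : size s = n by rewrite size_sort size_map size_enum_ord.
have sorted_s : sorted <%R s.
  rewrite lt_sorted_uniq_le sort_uniq map_inj_uniq// enum_uniq/=.
  exact: (sort_sorted le_total).
have zz : increasing_zeros (\sum_(m < n) cn m *: phi m) n (fun i => nth 0 s i).
  split=> i ip.
    have : nth 0 s i \in s by rewrite mem_nth// szs.
    by rewrite mem_sort => /mapP[j _ ->]; split; [exact: XI|exact: f0].
  have := sorted_ltn_nth lt_trans 0 sorted_s; apply=> //.
    by rewrite inE szs ltnW.
  by rewrite inE szs.
apply/matrixP => i j; rewrite ord1 [RHS]mxE -cnc.
exact: chebyshev zz _ (ltn_ord j).
Qed.

Lemma chebyshev_separates n (X : 'I_n -> R) (v : 'cV[R]_n) :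
  injective X -> (forall i, X i \in `[a, b]) ->
  (forall m, (m < n)%N -> \sum_i v i 0 * phi m (X i) = 0) -> v = 0.
Proof.
move=> injX XI vphi; rewrite -[v](mulKmx (chebyshev_unitmx injX XI)).
set Fv := _ *m v; suff -> : Fv = 0 by rewrite mulmx0.
apply/matrixP => m j; rewrite !mxE ord1 -[RHS](vphi m (ltn_ord m)).
by apply: eq_bigr => i _; rewrite mxE mulrC.
Qed.

End PoincareBasisTheory.

(** * Optimal weights and the Poincare quadrature *)

Section Quadratures.
Context {R : realType}.
Variables (a b : R) (mu : probability (measurableTypeR R) R) (rho : R -> R).
Hypothesis ab : a < b.
Hypothesis hrho : is_density a b mu rho.
Variables (phi : nat -> R -> R) (lam : nat -> R).
Hypothesis basis : poincare_basis a b mu phi lam.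
Implicit Types (h : R -> R) (S : inner_space R).

Notation L2_inner := (L2_inner a b mu).
Notation dirichlet := (dirichlet a b mu).
Notation alpha m := (1 + lam m)^-1.
Notation phiH1 := (phi_H1 basis).

Lemma phi0E x : x \in `[a, b] -> phi 0%N x = 1.
Proof. by case: basis => _ _ + _ _; exact. Qed.

Lemma alpha_gt0 m : 0 < alpha m.
Proof.
by rewrite invr_gt0 ltr_wpDr//; exact: lam_ge0 (lam_0 basis) (lam_lt basis) m.
Qed.

Lemma alpha0 : alpha 0%N = 1.
Proof. by rewrite (lam_0 basis) addr0 invr1. Qed.

Lemma integral_phi0 h : \int[mu]_(x in `[a, b]) h x = L2_inner h (phi 0%N).
Proof. by apply: eq_Rintegral => x /set_mem xab; rewrite phi0E// mulr1. Qed.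

Lemma integral_phi m : \int[mu]_(x in `[a, b]) phi m x = (m == 0%N)%:R.
Proof. by rewrite integral_phi0 (phi_orthonormal basis). Qed.

(** The constant function 1 represents the integral in H^1, because it has no
    Dirichlet energy. *)
Lemma H1_integral h : in_H1 a b mu h ->
  \int[mu]_(x in `[a, b]) h x = H1_inner a b mu h (phi 0%N).
Proof.
move=> hH1; rewrite integral_phi0 /H1_inner -/(dirichlet h (phi 0%N)).
have -> : dirichlet h (phi 0%N) = dirichlet (phi 0%N) h by exact: L2_innerC.
by rewrite (phi_eigen basis)// (lam_0 basis) mul0r addr0.
Qed.

Lemma optimal_H1 K n (X : 'I_n -> R) :
  reproducing_kernel `[a, b] (H1 a b mu) K ->
  injective X -> (forall i, X i \in `[a, b]) ->
  gram K X \in unitmx /\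
  exists w : 'cV[R]_n,
    [/\ optimal_weights a b mu (H1 a b mu) X w,
        w = invmx (gram K X) *m const_mx 1,
        wce a b mu (H1 a b mu) X w ^+ 2 =
          1 - ((const_mx 1)^T *m invmx (gram K X) *m const_mx 1 : 'M[R]_1) 0 0 &
        wce a b mu (H1 a b mu) X w ^+ 2 = 1 - \sum_(i < n) w i 0].
Proof.
move=> HK injX XI.
have hS := H1_prehilbert ab hrho.
have sep (v : 'cV[R]_n) :
    (forall h, carrier (H1 a b mu) h -> \sum_i v i 0 * h (X i) = 0) -> v = 0.
  move=> vh; apply: (chebyshev_separates ab hrho basis injX XI) => m _.
  by apply: vh; exact: phiH1.
have inte : inner (H1 a b mu) (phi 0%N) (phi 0%N) = 1.
  by rewrite -[LHS](H1_integral (phiH1 0%N)) integral_phi.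
split; first exact: (gram_unit hS HK XI sep).
exists (invmx (gram K X) *m const_mx 1).
exact: (optimal_weights_gram hS HK (phiH1 0%N) phi0E inte H1_integral XI sep).
Qed.

Lemma truncated_kernelE M x : truncated_kernel phi lam M x =
  \sum_(m < M.+1) (alpha m * phi m x) *: phi m.
Proof. by apply/funext => y; rewrite lincombE. Qed.

(** At M + 1 distinct points the Chebyshev property inverts the expression of
    the kernel sections k x_j in terms of phi 0, ..., phi M, so these lie in
    the space spanned by the kernel sections. *)
Lemma truncated_rkhs_phi S M : is_prehilbert S ->
  reproducing_kernel `[a, b] S (truncated_kernel phi lam M) ->
  forall m, (m <= M)%N -> carrier S (phi m).
Proof.
move=> hS HK m mM.
pose X (j : 'I_M.+1) : R := a + (b - a) * (j%:R / M.+1%:R).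
have ba : 0 < b - a by rewrite subr_gt0.
have injX : injective X.
  move=> i j /addrI/(mulfI (lt0r_neq0 ba))/(mulIf _) E; apply/val_inj/eqP.
  by rewrite -(eqr_nat R) E// invr_neq0// pnatr_eq0.
have XI j : X j \in `[a, b].
  have /andP[q0 q1] : 0 <= (j%:R / M.+1%:R : R) <= 1.
    by rewrite divr_ge0//= ler_pdivrMr// mul1r ler_nat ltnW.
  rewrite in_itv/= lerDl mulr_ge0 ?(ltW ba)//= -lerBrDl.
  by rewrite ler_piMr// ltW.
have Fu := chebyshev_unitmx ab hrho basis injX XI.
set F := \matrix_(_, _) _ in Fu.
have l1 : (m < M.+1)%N by [].
pose c j : R := invmx F j (Ordinal l1).
have -> : phi m = (alpha m)^-1 *: \sum_(j < M.+1) c j *: truncated_kernel phi lam M (X j).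
  apply/funext => y.
  transitivity ((alpha m)^-1 *
    (\sum_(j < M.+1) c j *: truncated_kernel phi lam M (X j)) y); last by [].
  rewrite lincombE; under eq_bigr do rewrite /truncated_kernel mulr_sumr.
  rewrite exchange_big/=.
  have -> : \sum_(k < M.+1) \sum_(i < M.+1) c i * (alpha k * phi k (X i) * phi k y)
      = \sum_(k < M.+1) alpha k * phi k y * (k == Ordinal l1)%:R.
    apply: eq_bigr => k _; have := mulmxV Fu.
    move=> /matrixP/(_ k (Ordinal l1)); rewrite !mxE => <-.
    by rewrite mulr_sumr; apply: eq_bigr => i _; rewrite mxE /c; ring.
  rewrite (bigD1 (Ordinal l1))//= big1 => [|k /negPf->]; last by rewrite mulr0.
  by rewrite eqxx mulr1 addr0 mulrA mulVf ?mul1r// gt_eqF// alpha_gt0.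
apply: (carrierZ hS); apply: (carrier_sum hS) => j.
by case: (HK _ (XI j)).
Qed.

(** Reproduction writes h on [a, b] as the sum of alpha m <h, phi m> phi m;
    only the term m = 0 has a nonzero integral, and alpha 0 = 1. *)
Lemma truncated_rkhs_integral S M h : is_prehilbert S ->
  reproducing_kernel `[a, b] S (truncated_kernel phi lam M) ->
  carrier S h -> \int[mu]_(x in `[a, b]) h x = inner S h (phi 0%N).
Proof.
move=> hS HK Sh; have phiS := truncated_rkhs_phi hS HK.
have phiS' (m : 'I_M.+1) : carrier S (phi m) by apply: phiS; rewrite -ltnS.
pose beta m := alpha m * inner S h (phi m).
have hE x : x \in `[a, b] -> h x = (\sum_(m < M.+1) beta m *: phi m) x.
  move=> xab; have [_ /(_ _ Sh) <-] := HK _ xab.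
  rewrite truncated_kernelE lincombE.
  rewrite (inner_sumr hS _ _ (fun m : 'I_M.+1 => alpha m * phi m x) phiS' Sh).
  by apply: eq_bigr => m _; rewrite /beta; ring.
transitivity (\int[mu]_(x in `[a, b]) (\sum_(m < M.+1) beta m *: phi m) x).
  by apply: eq_Rintegral => x /set_mem; exact: hE.
rewrite integral_phi0.
have /= -> := @inner_suml _ _ (L2_prehilbert ab hrho) _ (index_enum 'I_M.+1) xpredT
  (fun m => beta m) (fun m => phi m) (phi 0%N) (fun m => phiH1 m) (phiH1 0%N).
rewrite big_ord_recl/= (phi_orthonormal basis) mulr1 big1 => [|m _].
  by rewrite addr0 /beta alpha0 mul1r.
by rewrite (phi_orthonormal basis) mulr0.
Qed.

Lemma optimal_truncated S M n (X : 'I_n -> R) (k := truncated_kernel phi lam M) :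
  is_rkhs `[a, b] S k -> (n <= M.+1)%N ->
  injective X -> (forall i, X i \in `[a, b]) ->
  gram k X \in unitmx /\
  exists w : 'cV[R]_n,
    [/\ optimal_weights a b mu S X w,
        w = invmx (gram k X) *m const_mx 1,
        wce a b mu S X w ^+ 2 =
          1 - ((const_mx 1)^T *m invmx (gram k X) *m const_mx 1 : 'M[R]_1) 0 0 &
        wce a b mu S X w ^+ 2 = 1 - \sum_(i < n) w i 0].
Proof.
move=> [[S0 Slin [Sl Ss Sp _] _] HK] nM injX XI.
have hS : is_prehilbert S by split.
have phiS := truncated_rkhs_phi hS HK.
have sep (v : 'cV[R]_n) :
    (forall h, carrier S h -> \sum_i v i 0 * h (X i) = 0) -> v = 0.
  move=> vh; apply: (chebyshev_separates ab hrho basis injX XI) => m mn.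
  by apply/vh/phiS; rewrite -ltnS (leq_trans mn).
have S1 : carrier S (phi 0%N) by exact: phiS.
have int_e h : carrier S h -> \int[mu]_(x in `[a, b]) h x = inner S h (phi 0%N).
  exact: truncated_rkhs_integral hS HK.
have inte : inner S (phi 0%N) (phi 0%N) = 1 by rewrite -int_e// integral_phi.
split; first exact: (gram_unit hS HK XI sep).
exists (invmx (gram k X) *m const_mx 1).
exact: (optimal_weights_gram hS HK S1 phi0E inte int_e XI sep).
Qed.

(** The Gram form is sum_m alpha m (sum_i v_i phi m (X i))^2. *)
Lemma truncated_gram_unit M n (X : 'I_n -> R) : (n <= M.+1)%N ->
  injective X -> (forall i, X i \in `[a, b]) ->
  gram (truncated_kernel phi lam M) X \in unitmx.
Proof.
move=> nM injX XI; apply: unitmx_definite => v.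
have -> : (v^T *m gram (truncated_kernel phi lam M) X *m v) 0 0 =
    \sum_(m < M.+1) alpha m * (\sum_i v i 0 * phi m (X i)) ^+ 2.
  transitivity (\sum_j \sum_i \sum_(m < M.+1)
      alpha m * (v i 0 * phi m (X i)) * (v j 0 * phi m (X j))).
    rewrite mxE; apply: eq_bigr => j _; rewrite mxE mulr_suml.
    apply: eq_bigr => i _; rewrite !mxE /truncated_kernel mulr_sumr mulr_suml.
    by apply: eq_bigr => m _; ring.
  under eq_bigr do rewrite exchange_big/=.
  rewrite exchange_big/=; apply: eq_bigr => m _.
  rewrite expr2 mulrA mulr_sumr; apply: eq_bigr => j _.
  by rewrite mulr_sumr mulr_suml.
move/eqP; rewrite psumr_eq0 => [/allP v0|m _]; last first.
  by rewrite mulr_ge0 ?sqr_ge0// ltW// alpha_gt0.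
apply: (chebyshev_separates ab hrho basis injX XI) => m mn.
have := v0 (Ordinal (leq_trans mn nM)) (mem_index_enum _).
by rewrite /= mulf_eq0 gt_eqF ?alpha_gt0//= sqrf_eq0 => /eqP.
Qed.

Lemma positive_exact_perturb n (X : 'I_n -> R) w i j (t : R) :
  positive_exact a b mu phi X w -> X i = X j -> i != j -> 0 < t < w j 0 ->
  positive_exact a b mu phi X
    (\col_k (w k 0 + t * ((k == i)%:R - (k == j)%:R))).
Proof.
move=> [XI wpos wex] Xij ij /andP[t0 tw].
have ji : (j == i) = false by rewrite eq_sym (negPf ij).
split=> //.
  move=> k; rewrite mxE; case: eqP => [->|_].
    by rewrite (negPf ij) subr0 mulr1 addr_gt0.
  case: eqP => [->|_]; last by rewrite subrr mulr0 addr0.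
  by rewrite sub0r mulrN1 subr_gt0.
move=> m mn; rewrite wex// /quad; under [RHS]eq_bigr do rewrite mxE mulrDl.
rewrite big_split/= -[LHS]addr0; congr (_ + _).
rewrite (bigD1 i)//= (bigD1 j) ?ji//= big1 => [|k /andP[/negPf ki /negPf kj]].
  by rewrite !eqxx (negPf ij) ?ji Xij /=; ring.
by rewrite ki kj/=; ring.
Qed.

(** Between coinciding nodes weight can be moved without changing the
    quadrature; moving it towards the heavier one increases the sum of squared
    weights, so the result is no renumbering of the original. *)
Lemma poincare_nodes_injective n (X : 'I_n -> R) w :
  poincare_quadrature a b mu phi X w -> injective X.
Proof.
move=> [pe uniq].
suff H i j : X i = X j -> i != j -> w j 0 <= w i 0 -> False.
  move=> i j Xij; apply/eqP/negPn/negP => ij.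
  have [wji|/ltW wij] := leP (w j 0) (w i 0); first exact: H Xij ij wji.
  by apply: (H j i) => //; rewrite eq_sym.
move=> Xij ij wji; have ji : (j == i) = false by rewrite eq_sym (negPf ij).
have wj : 0 < w j 0 by case: pe.
pose t := w j 0 / 2.
have t0 : 0 < t by rewrite divr_gt0.
have tw : 0 < t < w j 0 by rewrite t0 /t ltr_pdivrMr// ltr_pMr// ltr1n.
have [s sP] := uniq _ _ (positive_exact_perturb pe Xij ij tw).
pose w' k := w k 0 + t * ((k == i)%:R - (k == j)%:R).
have : \sum_k (w' k ^+ 2 - w k 0 ^+ 2) = 0.
  rewrite sumrB [X in _ - X](reindex_inj (@perm_inj _ s)) -sumrB big1// => k _.
  by have [_] := sP k; rewrite mxE -/(w' k) => ->; rewrite subrr.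
rewrite (bigD1 i)//= (bigD1 j) ?ji//= big1 => [|k /andP[/negPf ki /negPf kj]].
  rewrite /w' !eqxx (negPf ij) ?ji /= => E.
  by have := t0; move: E; nra.
by rewrite /w' ki kj/=; ring.
Qed.

(** Exactness turns K_M(X, X) w into the expansion sum_m alpha m phi m (X i)
    times the integral of phi m, in which only m = 0 survives. *)
Lemma poincare_weights n (X : 'I_n -> R) w
    (G := gram (truncated_kernel phi lam (2 * n).-1) X) :
  (0 < n)%N -> poincare_quadrature a b mu phi X w ->
  G \in unitmx /\ w = invmx G *m const_mx 1.
Proof.
move=> n0 pq; have [[XI wpos wex] _] := pq.
have Gu : G \in unitmx.
  apply: truncated_gram_unit => //; last exact: poincare_nodes_injective pq.
  by rewrite prednK ?muln_gt0// leq_pmull.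
split=> //; rewrite -[LHS](mulKmx Gu); congr (_ *m _).
apply/matrixP => i j; rewrite ord1 !mxE.
transitivity (\sum_(m < (2 * n).-1.+1) alpha m * phi m (X i) * quad X w (phi m)).
  under eq_bigr do rewrite mxE /truncated_kernel mulr_suml.
  rewrite exchange_big/=; apply: eq_bigr => m _; rewrite /quad mulr_sumr.
  by apply: eq_bigr => k _; ring.
rewrite big_ord_recl/= -wex// integral_phi alpha0 phi0E// !mulr1 big1 ?addr0// => m _.
rewrite -wex; last by have := ltn_ord m.
by rewrite integral_phi mulr0.
Qed.

End Quadratures.

Theorem proposition8 (R : realType) (a b : R)
    (mu : probability (measurableTypeR R) R)
    (K : R -> R -> R) (phi : nat -> R -> R) (lam : nat -> R) :
  a < b ->
  bounded_perturbation a b mu ->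
  reproducing_kernel `[a, b] (H1 a b mu) K ->
  poincare_basis a b mu phi lam ->
  [/\ forall (n : nat) (X : 'I_n -> R),
        (0 < n)%N -> injective X -> (forall i, X i \in `[a, b]) ->
        gram K X \in unitmx /\
        exists w : 'cV[R]_n,
          [/\ optimal_weights a b mu (H1 a b mu) X w,
              w = invmx (gram K X) *m const_mx 1,
              wce a b mu (H1 a b mu) X w ^+ 2 =
                1 - ((const_mx 1)^T *m invmx (gram K X) *m const_mx 1
                     : 'M[R]_1) 0 0 &
              wce a b mu (H1 a b mu) X w ^+ 2 = 1 - \sum_(i < n) w i 0],
      forall (M : nat) (S : inner_space R),
        (0 < M)%N -> is_rkhs `[a, b] S (truncated_kernel phi lam M) ->
        forall (n : nat) (X : 'I_n -> R),
        (0 < n)%N -> (n <= M.+1)%N ->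
        injective X -> (forall i, X i \in `[a, b]) ->
        let G := gram (truncated_kernel phi lam M) X in
        G \in unitmx /\
        exists w : 'cV[R]_n,
          [/\ optimal_weights a b mu S X w,
              w = invmx G *m const_mx 1,
              wce a b mu S X w ^+ 2 =
                1 - ((const_mx 1)^T *m invmx G *m const_mx 1 : 'M[R]_1) 0 0 &
              wce a b mu S X w ^+ 2 = 1 - \sum_(i < n) w i 0] &
      forall (n : nat) (X : 'I_n -> R) (w : 'cV[R]_n),
        (0 < n)%N -> poincare_quadrature a b mu phi X w ->
        let G := gram (truncated_kernel phi lam (2 * n).-1) X in
        G \in unitmx /\ w = invmx G *m const_mx 1].
Proof.
move=> ab [rho [crho rho_gt0 _ muE]] HK basis.
have hrho : is_density a b mu rho by split.
split.
- by move=> n X _ injX XI; exact: (optimal_H1 ab hrho basis HK injX XI).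
- move=> M S _ HS n X _ nM injX XI.
  exact: (optimal_truncated ab hrho basis HS nM injX XI).
- by move=> n X w n0 pq; exact: (poincare_weights ab hrho basis n0 pq).
Qed.
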